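(* Let $\alpha\in(0,1)$ and let $\{Z(n),n\ge 0\}$ be a Galton-Watson branching process with $Z(0)=1$ whose offspring number $\xi$ has probability generating function $f(s)=\mathbf{E}s^{\xi}$ satisfying $$\mathbf{E}\xi=1,\qquad f(s)=s+(1-s)^{1+\alpha}L(1-s),\quad 0\le s\le 1,$$ where $L(z)$ is slowly varying as $z\downarrow 0$. Let $\varphi(n)>0$, $n=1,2,\ldots$, be a deterministic function such that $\varphi(n)\to\infty$ and $\varphi(n)/n\to 0$ as $n\to\infty$, and put $\mathcal{H}(n):=\{0<(1-f_{\varphi(n)}(0))Z(n)\le 1\}$, where $f_n$ is the $n$th iterate of $f$. Let $d(n)$ be the distance from moment $n$ to the birth moment of the most recent common ancestor of all particles existing at moment $n$. Then, for any $x\in(0,\infty)$, $$\lim_{n\to\infty}\mathbf{P}\big(d(n)\le x\varphi(n)\,\big|\,\mathcal{H}(n)\big)=\alpha\,\Gamma(1+\alpha)\,x\,M(x^{-1/\alpha}),$$ where $M$ is the probability distribution function on $[0,\infty)$ determined by $$\int_0^\infty e^{-\lambda y}\,dM(y)=1-\frac{1}{(1+\lambda^{-\alpha})^{1/\alpha}},\qquad \lambda>0.$$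
   Context: The iterates are $f_0(s)=s$, $f_n(s)=f(f_{n-1}(s))$, $n\ge1$, so $\mathbf{E}s^{Z(n)}=f_n(s)$. A positive (measurable) function $L$ is slowly varying as $z\downarrow0$ if $L(cz)/L(z)\to1$ as $z\downarrow0$ for every $c>0$; at $s=1$ the term $(1-s)^{1+\alpha}L(1-s)$ is read as $0$. $f_{\varphi(n)}$ means $f_{\lfloor\varphi(n)\rfloor}$ when $\varphi(n)$ is not an integer. For $0\le m\le n$, $Z(m,n)$ is the number of particles of generation $m$ having a positive number of descendants in generation $n$, with $Z(n,n)=Z(n)$. Define $b(n):=\max\{0\le m<n: Z(m,n)=1\}$ (the birth moment of the most recent common ancestor; well defined on $\{Z(n)>0\}$ since then $Z(0,n)=1$) and $d(n):=n-b(n)$. It is known that $M$ is a proper nondegenerate distribution with $M(y)>0$ for all $y>0$. $\Gamma$ is the Gamma function. *)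

(* Defs.v *)
From HB Require Import structures.
From mathcomp Require Export all_boot all_order all_algebra.
From mathcomp Require Export all_classical all_reals all_analysis.

Set Implicit Arguments.
Unset Strict Implicit.
Unset Printing Implicit Defensive.

Export Order.TTheory GRing.Theory Num.Theory.
Export numFieldNormedType.Exports.

Local Open Scope classical_set_scope.
Local Open Scope ring_scope.

(** * Genealogical trees

    Particles carry Ulam-Harris labels: the root is [::] and the children of
    [u] are [rcons u 0], ..., [rcons u (off u).-1].  Hence a particle [v]
    descends from [u] exactly when [u] is a prefix of [v]. *)

Definition offspring := seq nat -> nat.

Fixpoint generation (off : offspring) (n : nat) : seq (seq nat) :=
  if n is m.+1 then
    [seq rcons u i | u <- generation off m, i <- iota 0 (off u)]
  else [:: [::]].

(* Z(n) *)
Definition popsize (off : offspring) (n : nat) : nat := size (generation off n).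

(* Z(m,n), for m <= n *)
Definition reduced_popsize (off : offspring) (m n : nat) : nat :=
  count (fun u => has (prefix u) (generation off n)) (generation off m).

(* b(n): the maximum is over a nonempty set (it contains m = 0) as soon as
   0 < n and 0 < Z(n); otherwise the value is the junk value 0. *)
Definition mrca_birth (off : offspring) (n : nat) : nat :=
  (\max_(m < n | reduced_popsize off m n == 1) m)%N.

(* d(n) *)
Definition mrca_dist (off : offspring) (n : nat) : nat :=
  (n - mrca_birth off n)%N.

(** * Probability *)

Definition mutually_independent (d d' : measure_display)
    (T : measurableType d) (T' : measurableType d') (R : realType)
    (P : probability T R) (I : eqType) (X : I -> {RV P >-> T'}) : Prop :=
  forall (s : seq I) (A : I -> set T'), uniq s ->
    (forall i, measurable (A i)) ->
    P (\bigcap_(i in [set` s]) (X i @^-1` A i))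
      = (\prod_(i <- s) P (X i @^-1` A i))%E.

Definition iid_copies (d d' : measure_display)
    (T : measurableType d) (T' : measurableType d') (R : realType)
    (P : probability T R) (xi : {RV P >-> T'})
    (I : eqType) (X : I -> {RV P >-> T'}) : Prop :=
  mutually_independent X /\
  forall i, distribution P (X i) =1 distribution P xi.

(* Elementary conditional probability P(A | B); junk value 0 if P(B) = 0. *)
Definition cond_prob (d : measure_display) (T : measurableType d)
    (R : realType) (P : probability T R) (A B : set T) : R :=
  fine (P (A `&` B)) / fine (P B).

(* s |-> E s^xi, used for 0 <= s <= 1, where the expectation is finite;
   0 ^+ 0 = 1. *)
Definition pgf (d : measure_display) (T : measurableType d) (R : realType)
    (P : probability T R) (xi : {RV P >-> nat}) (s : R) : R :=
  fine ('E_P[fun w => (s ^+ xi w)%R])%E.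

(** * Analysis *)

(* Only the values of L on ]0, 1] matter. *)
Definition slowly_varying_at0 (R : realType) (L : R -> R) : Prop :=
  [/\ forall z, 0 < z <= 1 -> 0 < L z,
      measurable_fun (`]0, 1]%classic : set R) L
    & forall c, 0 < c -> L (c * z) / L z @[z --> 0^'+] --> (1 : R)].

(* Euler's Gamma function, for z > 0 *)
Definition Gamma (R : realType) (z : R) : R :=
  \int[lebesgue_measure]_(t in `]0, +oo[) (t `^ (z - 1) * expR (- t)).

(* M is the distribution function (right-continuous, limits 0 and 1) of a
   probability distribution on [0, +oo[ with the prescribed Laplace-Stieltjes
   transform; the integral includes a possible atom at 0. *)
Definition is_limit_df (R : realType) (alpha : R)
    (M : cumulativeBounded (0 : R) (1 : R)) : Prop :=
  (forall y, y < 0 -> M y = 0) /\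
  forall lam, 0 < lam ->
    (\int[lebesgue_stieltjes_measure M]_(y in `[0%R, +oo[)
        (expR (- lam * y))%:E
      = (1 - 1 / (1 + lam `^ (- alpha)) `^ (1 / alpha))%:E)%E.

(* Main.v *)
Require Import Defs.
From mathcomp Require Import measurable_realfun ring lra.

Set Implicit Arguments.
Unset Strict Implicit.
Unset Printing Implicit Defensive.

(** Write Q(n) = P(Z(n) > 0), G(z) = z^(1+alpha) L(z) and gap(n) = Q(n) - Q(n+1)
    = G(Q(n)).

    Since Z(m,n) is nondecreasing in m, for 1 <= k <= n and Z(n) > 0 one has
    d(n) <= k exactly when Z(n-k,n) = 1.  Conditioning on the offspring of the
    root, P(Z(m+1,m+1+k) = 1, Z(m+1+k) in B) is f'(f_(m+k)(0)) times the same
    probability with m in place of m+1, and convexity of f bounds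
    f'(f_j(0)) between gap(j)/gap(j-1) and gap(j+1)/gap(j).  The products
    telescope, so the joint probability is equivalent to
    P(Z(k) in B) gap(n)/gap(k).

    By convexity of G and slow variation, the increments of Q(n)/gap(n) tend to
    alpha, hence n gap(n)/Q(n) -> 1/alpha, and Q is regularly varying with index
    -1/alpha.  As exp(-lam Q(k)) lies between
    iterates f_j(0) with j/k close to lam^(-alpha), the Laplace transforms of
    Q(k) Z(k) given Z(k) > 0, and of Q(phi(n)) Z(n) on Z(n) > 0 normalised by
    phi(n) gap(n), converge to those of M and of y^alpha/Gamma(1+alpha).

    M is not known to be continuous at x^(-1/alpha).  Right continuity
    suffices for the upper bound; for the lower bound, d(n) <= x phi(n) is
    replaced by d(n) <= x' phi(n) with x' < x. *)

(** * Family trees *)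

(** The constant comes from one quotient. Let k and m be the integer parts of x phi(n) and phi(n).
    The condition Q(m) Z(k) <= 1 reads Q(k) Z(k) <= Q(k)/Q(m), and Q(k)/Q(m) tends to x^(-1/alpha);
    so the joint probability is close to Q(k) M(x^(-1/alpha)) gap(n)/gap(k), while P(H(n)) is close
    to m gap(n)/Gamma(1+alpha). Here gap(n) cancels, and Q(k)/gap(k) ~ alpha k with k/m -> x leaves
    the stated limit. Slow variation speaks of fixed ratios c, whereas the step from Q(n) to Q(n+1)
    has a ratio that moves with n. Convexity bridges this: the slope of G over the short step is
    caught between secants over [(1-h) Q(n), Q(n)] and [Q(n), (1+h) Q(n)], and G(z)/z is monotone.
    The measure with distribution function y^alpha/Gamma(1+alpha) is infinite, so it is not a weak
    limit of probabilities. Both limits are therefore taken through polynomials in expR(- lam y)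
    without constant term, which are integrable in either case. Independence of the family (X u) is
    used once, to find the law of a tree cut at height n; everything else is computed from that
    discrete law by splitting at the root. *)

Definition child_tree (off : offspring) (i : nat) : offspring := fun v => off (i :: v).

(** [generation] grows a tree at its leaves; conditioning on the offspring of the root needs the
    decomposition at the root, where labels are extended on the left. *)
Lemma generationS (off : offspring) (n : nat) :
  generation off n.+1 =
  flatten [seq map (cons i) (generation (child_tree off i) n) | i <- iota 0 (off [::])].
Proof.
elim: n => [|n IHn] /=.
  by rewrite cats0; elim: (iota _ _) => //= a s ->.
rewrite -[flatten [seq [seq rcons u i | i <- iota 0 (off u)] | u <- generation off n]]/(generation off n.+1).
rewrite IHn; elim: (iota 0 (off [::])) => //= i r IHr.
rewrite map_cat flatten_cat IHr; congr (_ ++ _).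
rewrite map_flatten -!map_comp; congr flatten.
by apply: eq_map => u /=; rewrite -map_comp.
Qed.

Lemma popsizeS (off : offspring) (n : nat) :
  popsize off n.+1 = \sum_(i < off [::]) popsize (child_tree off i) n.
Proof.
rewrite /popsize generationS size_flatten /shape -map_comp sumnE big_map.
rewrite -(big_mkord xpredT (fun i => size (generation (child_tree off i) n))).
by rewrite /index_iota subn0; apply: eq_bigr => i _; rewrite /= size_map.
Qed.

Lemma has_prefix_generationS (off : offspring) (n i : nat) (u : seq nat) :
  i < off [::] ->
  has (prefix (i :: u)) (generation off n.+1) =
  has (prefix u) (generation (child_tree off i) n).
Proof.
move=> ilt; rewrite generationS; apply/hasP/hasP => [[v]|[v vg pv]].
  case/flatten_mapP => i' _ /mapP[v' v'g ->]; rewrite prefix_cons.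
  by case/andP => /eqP ii' pv; exists v' => //; rewrite ii'.
exists (i :: v); last by rewrite prefix_cons eqxx.
by apply/flatten_mapP; exists i; rewrite ?mem_iota// map_f.
Qed.

Lemma reduced_popsizeS (off : offspring) (m n : nat) :
  reduced_popsize off m.+1 n.+1 =
  \sum_(i < off [::]) reduced_popsize (child_tree off i) m n.
Proof.
rewrite /reduced_popsize [in X in count _ X]generationS count_flatten -map_comp.
rewrite sumnE big_map.
rewrite -(big_mkord xpredT (fun i => count (fun u : seq nat =>
  has (prefix u) (generation (child_tree off i) n)) (generation (child_tree off i) m))).
rewrite /index_iota subn0 big_seq [RHS]big_seq; apply: eq_bigr => i.
rewrite mem_iota => /andP[_ ilt] /=; rewrite count_map; apply: eq_count => u.
by rewrite /preim /= has_prefix_generationS.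
Qed.

Lemma reduced_popsize0 (off : offspring) (n : nat) :
  reduced_popsize off 0 n = (0 < popsize off n).
Proof.
rewrite /reduced_popsize /= addn0 /popsize -has_predT.
by congr nat_of_bool; apply: eq_has => v; rewrite prefix0s.
Qed.

Lemma reduced_popsize_eq0 (off : offspring) (m n : nat) : m <= n ->
  (reduced_popsize off m n == 0) = (popsize off n == 0).
Proof.
elim: m n off => [|m IHm] n off.
  by rewrite reduced_popsize0; case: (popsize _ _).
case: n => // n.
move=> mn; rewrite reduced_popsizeS popsizeS !sum_nat_eq0.
by apply: eq_forallb => i; rewrite IHm.
Qed.

(** Splitting at the root lowers both generations by one. In the base case Z(0,n) is 0 or 1, and
    Z(m',n) vanishes only together with Z(n). *)
Lemma leq_reduced_popsize (off : offspring) (m m' n : nat) : m <= m' <= n ->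
  reduced_popsize off m n <= reduced_popsize off m' n.
Proof.
move=> /andP[]; elim: m m' n off => [|m IHm] m' n off.
  rewrite reduced_popsize0 lt0n => _ m'n.
  by rewrite -(reduced_popsize_eq0 off m'n); case: reduced_popsize.
case: m' n => [|m'] [|n] // mm' m'n.
by rewrite !reduced_popsizeS; apply: leq_sum => i _; apply: IHm.
Qed.

(** [0 < k] puts n - k in the range of the maximum. Conversely, some m >= n - k has Z(m,n) = 1, and
    monotonicity squeezes Z(n-k,n) between 1 and 1. *)
Lemma mrca_dist_leq (off : offspring) (k n : nat) : 0 < k <= n ->
  0 < popsize off n ->
  (mrca_dist off n <= k) = (reduced_popsize off (n - k) n == 1).
Proof.
move=> /andP[k0 kn] Zn; rewrite /mrca_dist leq_subCl.
have nkn : n - k < n by rewrite ltn_subrL k0 (leq_trans k0).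
apply/idP/idP; last first.
  by move=> r1; rewrite /mrca_birth (bigD1 (Ordinal nkn))//= leq_maxl.
have r0 m : m <= n -> 0 < reduced_popsize off m n.
  by move=> mn; rewrite lt0n reduced_popsize_eq0// -lt0n.
(* For k = n the inequality on the maximum is empty, 0 being also its default value; Z(0,n) = 1 then
   follows from Z(n) > 0. *)
case: (posnP (n - k)) => [-> _|nk0 le_b]; first by rewrite reduced_popsize0 Zn.
suff [m r1 mb] : exists2 m : 'I_n, reduced_popsize off m n == 1 & n - k <= m.
  rewrite eqn_leq r0 ?leq_subr// andbT -(eqP r1).
  by apply: leq_reduced_popsize; rewrite mb ltnW.
apply/exists_inP; move: le_b; apply: contraLR; rewrite negb_exists_in => /forall_inP h.
rewrite -ltnNge -(prednK nk0) ltnS; apply/bigmax_leqP => i ri.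
by rewrite -ltnS (prednK nk0) ltnNge h.
Qed.

(* Trees cut at height n, so that the law of [trunc n] is discrete. *)
Fixpoint ttree (n : nat) : countType :=
  if n is m.+1 then (seq (ttree m) : countType) else (unit : countType).

Fixpoint trunc (n : nat) (off : offspring) : ttree n :=
  match n return ttree n with
  | m.+1 => [seq trunc m (child_tree off i) | i <- iota 0 (off [::])]
  | 0 => tt
  end.

Lemma trunc_generation (n j : nat) (off off' : offspring) : j <= n ->
  trunc n off = trunc n off' -> generation off j = generation off' j.
Proof.
elim: n j off off' => [|n IHn] [|j] off off' //= jn ht.
rewrite -[flatten _]/(generation off j.+1) -[RHS]/(generation off' j.+1).
have h0 : off [::] = off' [::] by move/(congr1 size): ht; rewrite !size_map !size_iota.
rewrite !generationS; congr flatten; rewrite -h0 in ht *.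
apply/eq_in_map => i ilt; congr map; apply: IHn => //.
by move/eq_in_map: ht; apply.
Qed.

(** If the r i add up to 1, a single index i carries the sum; as r and z vanish together, it also
    carries all of the second sum. The indicator becomes a sum of products of functions of separate
    indices, the form to which independence of the child trees applies. *)
Lemma sum_eq1_prod (j : nat) (r z : 'I_j -> nat) (p : pred nat) :
  (forall i, (r i == 0) = (z i == 0)) -> ~~ p 0 ->
  ((\sum_i r i == 1) && p (\sum_i z i) : nat) =
  \sum_i \prod_l nat_of_bool (if l == i then (r l == 1) && p (z l) else z l == 0).
Proof.
move=> rz p0.
have prodE i : \prod_l nat_of_bool (if l == i then (r l == 1) && p (z l) else z l == 0)
    = [&& r i == 1, p (z i) & [forall l, (l != i) ==> (z l == 0)]].
  rewrite (bigD1 i)//= eqxx.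
  rewrite (eq_bigr (fun l => nat_of_bool (z l == 0))); last by move=> l /negbTE ->.
  case: forallP => [h|/forallP]; last first.
    rewrite negb_forall => /existsP[l]; rewrite negb_imply => /andP[li /negbTE zl].
    by rewrite (bigD1 l)//= zl mul0n muln0 !andbF.
  rewrite big1 ?muln1 ?andbT// => l li.
  by have /implyP/(_ li) -> := h l.
rewrite (eq_bigr _ (fun i _ => prodE i)).
have sumE i : [forall l, (l != i) ==> (z l == 0)] ->
   \sum_l r l = r i /\ \sum_l z l = z i.
  move=> /forallP h; split; rewrite (bigD1 i)//= big1 ?addn0// => l /(implyP (h l)).
    by rewrite -rz => /eqP.
  by move=> /eqP.
case: (boolP [exists i, [&& r i == 1, p (z i) & [forall l, (l != i) ==> (z l == 0)]]]).
  case/existsP => i Hi; rewrite [RHS](bigD1 i)// Hi.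
  case/and3P: Hi => ri pz h; have [-> ->] := sumE _ h.
  rewrite ri pz big1// => l li; apply/eqP; rewrite eqb0; apply/negP => /and3P[_ pl _].
  by move/forallP/(_ l)/implyP/(_ li)/eqP: h => h; rewrite h (negbTE p0) in pl.
rewrite negb_exists => /forallP h; rewrite [RHS]big1; last by move=> i _; rewrite (negbTE (h i)).
apply/eqP; rewrite eqb0; apply/negP => /andP[/eqP r1 pz].
have [i ri] : exists i, r i != 0.
  apply/existsP.
  apply: contra_eqT r1 => /existsPn H; rewrite big1// => i _; exact/eqP/negPn/H.
have zl l : l != i -> z l == 0.
  move=> li; rewrite -rz; move: r1; rewrite (bigD1 i)//= (bigD1 l)//=.
  case: (r i) ri => // a _ /eqP; rewrite addSn eqSS !addn_eq0.
  by case/and3P.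
have hi : [forall l, (l != i) ==> (z l == 0)] by apply/forallP => l; apply/implyP/zl.
have [rE zE] := sumE _ hi.
by move: (h i); rewrite -rE -zE r1 pz hi.
Qed.

Local Open Scope classical_set_scope.
Local Open Scope ring_scope.

(* [(v, k)] belongs to [constraints u t] when the copy of [t] planted at [u]
   forces the particle [v] to have [k] children. *)
Fixpoint constraints (n : nat) (u : seq nat) : ttree n -> seq (seq nat * nat) :=
  match n return ttree n -> seq (seq nat * nat) with
  | m.+1 => fun t => (u, size t) ::
      flatten [seq constraints (rcons u it.1) it.2 | it <- zip (iota 0 (size t)) t]
  | 0 => fun=> [::]
  end.

Definition subtree (off : offspring) (u : seq nat) : offspring :=
  fun v => off (u ++ v).

Lemma child_tree_subtree (off : offspring) (u : seq nat) (i : nat) :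
  child_tree (subtree off u) i = subtree off (rcons u i).
Proof. by apply/funext => v; rewrite /child_tree /subtree cat_rcons. Qed.

(** Reduces an event about a whole tree to finitely many conditions on single labels. *)
Lemma truncP (n : nat) (off : offspring) (u : seq nat) (t : ttree n) :
  (trunc n (subtree off u) == t) = all (fun c => off c.1 == c.2) (constraints u t).
Proof.
elim: n u t => [|n IHn] u t /=; first by case: t.
have -> : subtree off u [::] = off u by rewrite /subtree cats0.
have childrenP (s : seq (ttree n)) k :
    ([seq trunc n (child_tree (subtree off u) i) | i <- iota k (size s)] == s) =
    all (fun c => off c.1 == c.2)
      (flatten [seq constraints (rcons u it.1) it.2 | it <- zip (iota k (size s)) s]).
  elim: s k => //= a s IHs k.
  by rewrite all_cat -IHs -IHn -child_tree_subtree eqseq_cons.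
rewrite -childrenP; have [->//|neq] := eqVneq (off u) (size t).
by apply/eqP => /(congr1 size); rewrite size_map size_iota => /eqP; rewrite (negbTE neq).
Qed.

Lemma prefix_constraints (n : nat) (u : seq nat) (t : ttree n) (c : seq nat * nat) :
  c \in constraints u t -> prefix u c.1.
Proof.
elim: n u t c => //= n IHn u t c; rewrite inE => /predU1P[->/=|]; first exact: prefix_refl.
case/flatten_mapP => it _ /IHn; apply: prefix_trans.
by rewrite -cats1 prefix_prefix.
Qed.

(** Mutual independence concerns lists of distinct labels. Labels below different children of u
    differ at position [size u], and all of them are longer than u. *)
Lemma uniq_constraints (n : nat) (u : seq nat) (t : ttree n) :
  uniq (unzip1 (constraints u t)).
Proof.
elim: n u t => //= n IHn u t.
have in_children (s : seq (ttree n)) k v :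
    v \in unzip1 (flatten [seq constraints (rcons u it.1) it.2 | it <- zip (iota k (size s)) s]) ->
    exists2 i, (k <= i)%N & prefix (rcons u i) v.
  case/mapP => c /flatten_mapP[[i a]] /=.
  have [-> //|s0] := eqVneq s [::].
  move=> ia /prefix_constraints pc ->; exists i => //.
  have : i \in unzip1 (zip (iota k (size s)) s) by apply/mapP; exists (i, a).
  by rewrite unzip1_zip ?size_iota// mem_iota => /andP[].
apply/andP; split.
  apply/negP => /in_children[i _ /prefixP[v /(congr1 size)]].
  by rewrite size_cat size_rcons => /eqP; rewrite addSn -addnS -[X in X == _]addn0 eqn_add2l.
elim: (t : seq (ttree n)) (0%N) => //= a s IHs k.
rewrite /unzip1 map_cat cat_uniq IHn IHs andbT/=; apply/hasPn => v.
move=> /in_children[i ki /prefixP[v1 ->]]; apply/negP => /mapP[c /prefix_constraints].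
move=> /prefixP[v2 ->] /(congr1 (fun s => nth 0%N s (size u))).
by rewrite !cat_rcons !nth_cat ltnn subnn/= => ik; rewrite ik ltnn in ki.
Qed.

Definition family_tree (R : realType) (d : measure_display) (T : measurableType d)
    (P : probability T R) (X : seq nat -> {RV P >-> nat}) (w : T) : offspring :=
  fun u => X u w.

Definition offspring_prob (R : realType) (d : measure_display) (T : measurableType d)
    (P : probability T R) (xi : {RV P >-> nat}) (j : nat) : R :=
  fine (P (xi @^-1` [set j])).

Section galton_watson.
Context (R : realType) (d : measure_display) (T : measurableType d)
  (P : probability T R) (xi : {RV P >-> nat}) (X : seq nat -> {RV P >-> nat}).
Hypothesis iidX : iid_copies xi X.

Local Notation tree := (family_tree X).
Local Notation p := (offspring_prob xi).

(** The law of the Galton-Watson tree cut at height n: a product of offspring probabilities over the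
    particles of generations below n. *)
Fixpoint weight (n : nat) : ttree n -> R :=
  match n return ttree n -> R with
  | m.+1 => fun t => p (size t) * \prod_(a <- t) weight a
  | 0 => fun=> 1
  end.

Lemma weightE (n : nat) (u : seq nat) (t : ttree n) :
  \prod_(c <- constraints u t) p c.2 = weight t.
Proof.
elim: n u t => [|n IHn] u t /=; first by rewrite big_nil.
rewrite big_cons/=; congr (_ * _).
elim: (t : seq (ttree n)) (0%N) => [|a s IHs] k /=; first by rewrite !big_nil.
by rewrite big_cat big_cons/= IHn IHs.
Qed.

Lemma probE (u : seq nat) (j : nat) : P (X u @^-1` [set j]) = (p j)%:E.
Proof.
rewrite fineK//; first exact: (iidX.2 u [set j]).
by rewrite fin_num_measure//; apply: measurable_funPTI.
Qed.

(** A label carries only one constraint, so each set in the intersection is the preimage of a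
    singleton; writing it as a membership makes it a function of the label alone, as mutual
    independence requires. *)
Let truncE (n : nat) (u : seq nat) (t : ttree n) :
  [set w | trunc n (subtree (tree w) u) = t] =
  \bigcap_(v in [set` unzip1 (constraints u t)])
    (X v @^-1` [set k | (v, k) \in constraints u t]).
Proof.
apply/seteqP; split => w /=.
  move/eqP; rewrite truncP => /allP h v /mapP[[v' k] vk ->] /=.
  by move: (h _ vk) => /= /eqP; rewrite /family_tree => ->.
move=> h; apply/eqP; rewrite truncP; apply/allP => -[v k] vk /=.
have /h/= vk' : v \in unzip1 (constraints u t) by apply/mapP; exists (v, k).
have := uniq_constraints u t.
move: vk vk'; rewrite /family_tree; elim: (constraints u t) => //= -[a b] s IHs.
rewrite !inE => /orP[/eqP[-> ->]|vk] /orP[/eqP[e1]|vk'] /=.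
- by rewrite e1.
- by case/andP => /negP ab _; case: ab; apply/mapP; exists (a, X a w).
- by move=> _ /andP[/negP ab _]; case: ab; apply/mapP; exists (v, k) => //=; rewrite -e1.
- by case/andP => _; apply: IHs.
Qed.

Lemma measurable_trunc (n : nat) (u : seq nat) (t : ttree n) :
  measurable [set w | trunc n (subtree (tree w) u) = t].
Proof.
rewrite truncE; apply: fin_bigcap_measurable => // v _.
exact: measurable_funPTI.
Qed.

(** The right-hand side is free of u: every subtree has the law of the whole tree. *)
Lemma prob_trunc (n : nat) (u : seq nat) (t : ttree n) :
  P [set w | trunc n (subtree (tree w) u) = t] = (weight t)%:E.
Proof.
rewrite truncE iidX.1 ?uniq_constraints// -(weightE u) -prodEFin big_map.
have := uniq_constraints u t.
rewrite big_seq [RHS]big_seq => uq; apply: eq_bigr => -[v k] vk /=.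
rewrite -(probE v); congr (P _); apply/seteqP; split => w /=; last by move=> ->.
move: uq vk; elim: (constraints u t) => //= -[a b] s IHs /andP[h uq].
rewrite !inE => /orP[/eqP[-> ->]|vk] /orP[/eqP[]|vk'] /=.
- by [].
- by case/negP: h; apply/mapP; exists (a, X a w).
- by move=> e1 e2; case/negP: h; apply/mapP; exists (v, k) => //=; rewrite -e1.
- exact: IHs.
Qed.

End galton_watson.

(** * The branching property *)

Lemma indic_fiber (R : pzRingType) (T : Type) (C : eqType) (Y : T -> C) (a : C) (w : T) :
  \1_[set v | Y v = a] w = (Y w == a)%:R :> R.
Proof.
by rewrite indicE; congr (nat_of_bool _)%:R; apply/idP/eqP => [/set_mem|/mem_set].
Qed.

Section countable_fibers.
Context (d : measure_display) (T : measurableType d) (C : countType) (Y : T -> C).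
Hypothesis mY : forall a, measurable [set w | Y w = a].

Lemma measurable_preimage_countable (B : set C) : measurable (Y @^-1` B).
Proof.
have -> : Y @^-1` B = \bigcup_(a in B) [set w | Y w = a].
  by apply/seteqP; split => w /=; [exists (Y w)|case=> a /= Ba ->].
have -> : \bigcup_(a in B) [set w | Y w = a] =
    \bigcup_k (if pickle_inv k is Some a then
      (if a \in B then [set w | Y w = a] else set0) else set0).
  apply/seteqP; split => w /= [a].
    by move=> Ba Ya; exists (pickle a) => //; rewrite pickleK_inv (mem_set Ba).
  by move=> _; case: (pickle_inv a) => // b; case: ifPn => // /set_mem Bb; exists b.
apply: bigcup_measurable => k _.
by case: (pickle_inv k) => [a|//]; case: ifPn.
Qed.

(** With [Y] a truncated tree, this settles the measurability of everything that depends on finitely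
    many generations. *)
Lemma measurable_fun_countable (d' : measure_display) (T' : measurableType d')
    (V : T -> T') :
  (forall w w', Y w = Y w' -> V w = V w') -> measurable_fun setT V.
Proof.
move=> VY _ B _; rewrite setTI.
have -> : V @^-1` B = Y @^-1` (Y @` (V @^-1` B)).
  apply/seteqP; split => w /=; first by exists w.
  by case=> w' Bw' /VY <-.
exact: measurable_preimage_countable.
Qed.

Lemma integral_fibers (R : realType) (mu : {measure set T -> \bar R})
    (V : T -> R) : (forall w, 0 <= V w) -> measurable_fun setT V ->
  (\int[mu]_w (V w)%:E =
   \sum_(k <oo) \int[mu]_(w in [set w | pickle (Y w) = k]) (V w)%:E)%E.
Proof.
move=> V0 mV; have UT : \bigcup_k [set w | pickle (Y w) = k] = setT.
  by apply/seteqP; split => // w _; exists (pickle (Y w)).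
rewrite -{1}UT ge0_integral_bigcup//.
- by move=> k; apply: (measurable_preimage_countable (fun a => pickle a = k)).
- by rewrite UT; apply/measurable_EFinP.
- by move=> w _; rewrite lee_fin.
- by apply/trivIsetP => i j _ _ ij; apply/seteqP; split => // w [/= ->] /eqP; rewrite (negbTE ij).
Qed.

End countable_fibers.

(** Two different variables [Y] and [Y'] are allowed so that a child tree can be exchanged for the
    whole tree, and [X [::]] for [xi], one value at a time. *)
Lemma eq_integral_fibers (R : realType) (d : measure_display) (T : measurableType d)
    (C : countType) (mu : {measure set T -> \bar R}) (Y Y' : T -> C) (V V' : T -> R) :
  (forall a, measurable [set w | Y w = a]) ->
  (forall a, measurable [set w | Y' w = a]) ->
  (forall w, 0 <= V w) -> (forall w, 0 <= V' w) ->
  measurable_fun setT V -> measurable_fun setT V' ->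
  (forall a, \int[mu]_(w in [set w | Y w = a]) (V w)%:E =
     \int[mu]_(w in [set w | Y' w = a]) (V' w)%:E)%E ->
  (\int[mu]_w (V w)%:E = \int[mu]_w (V' w)%:E)%E.
Proof.
move=> mY mY' V0 V0' mV mV' VV'.
rewrite (integral_fibers mY)// (integral_fibers mY')//.
apply: eq_eseriesr => k _.
have fiberE (Z : T -> C) : [set w | pickle (Z w) = k] =
    if pickle_inv k is Some a then [set w | Z w = a] else set0.
  apply/seteqP; split => w /=; first by move=> <-; rewrite pickleK_inv.
  by have := @pickle_invK C k; case: pickle_inv => //= a <- /= ->.
rewrite !fiberE; case: (pickle_inv k) => [a|]; first exact: VV'.
by rewrite !integral_set0.
Qed.

Section branching.
Context (R : realType) (d : measure_display) (T : measurableType d)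
  (P : probability T R) (xi : {RV P >-> nat}) (X : seq nat -> {RV P >-> nat}).
Hypothesis iidX : iid_copies xi X.

Local Notation tree := (family_tree X).
Local Notation p := (offspring_prob xi).

Local Notation Ex := (fun V : T -> R => fine (\int[P]_w (V w)%:E)%E).

Lemma integral_unit_fin (D : set T) (V : T -> R) : measurable D -> measurable_fun setT V ->
  (forall w, 0 <= V w <= 1) -> (\int[P]_(w in D) (V w)%:E)%E \is a fin_num.
Proof.
move=> mD mV V01; rewrite ge0_fin_numE; last first.
  by apply: integral_ge0 => w _; rewrite lee_fin; case/andP: (V01 w).
apply: (@le_lt_trans _ _ (\int[P]_(w in D) 1%:E)%E); last first.
  rewrite integral_cst// mul1e; apply: le_lt_trans (ltry 1).
  by rewrite probability_le1.
apply: ge0_le_integral => //.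
- by move=> w _; rewrite lee_fin; case/andP: (V01 w).
- by apply/measurable_EFinP; apply: measurable_funTS.
- by move=> w _; rewrite lee_fin; case/andP: (V01 w).
Qed.

Let mtrunc n u t : measurable [set w | trunc n (subtree (tree w) u) = t].
Proof. exact: measurable_trunc. Qed.

Lemma measurable_fun_trunc (d' : measure_display) (T' : measurableType d') n
  (V : T -> T') : (forall w w', trunc n (tree w) = trunc n (tree w') -> V w = V w') ->
  measurable_fun setT V.
Proof. exact/measurable_fun_countable/(mtrunc [::]). Qed.

Lemma trunc_child n (off off' : offspring) i :
  trunc n.+1 off = trunc n.+1 off' -> (i < off [::])%N ->
  trunc n (child_tree off i) = trunc n (child_tree off' i).
Proof.
move=> /= ht ilt.
have h0 : off [::] = off' [::] by move/(congr1 size): ht; rewrite !size_map !size_iota.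
rewrite -h0 in ht; move/eq_in_map: ht; apply.
by rewrite mem_iota.
Qed.

Lemma trunc_root n (off off' : offspring) :
  trunc n.+1 off = trunc n.+1 off' -> off [::] = off' [::].
Proof. by move/(congr1 size); rewrite !size_map !size_iota. Qed.

Lemma measurable_root_children (n j : nat) (h : nat -> ttree n -> R) :
  measurable_fun setT (fun w =>
    (X [::] w == j)%:R * \prod_(i < j) h i (trunc n (child_tree (tree w) i)) : R).
Proof.
apply: (measurable_fun_trunc (n := n.+1)) => w w' e.
have e0 := trunc_root e; rewrite /family_tree in e0.
rewrite e0; case: eqP => [Xj|]; rewrite ?mul0r//; congr (_ * _).
by apply: eq_bigr => i _; rewrite (trunc_child e)// /family_tree e0 Xj.
Qed.

(** The branching property in product form: on the event of j children, the child trees behave as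
    independent copies of the whole tree. *)
Lemma integral_root_children (n j : nat) (h : nat -> ttree n -> R) :
  (forall i t, 0 <= h i t <= 1) ->
  (\int[P]_w ((X [::] w == j)%:R * \prod_(i < j) h i (trunc n (child_tree (tree w) i)))%:E =
   (p j * \prod_(i < j) Ex (fun w => h i (trunc n (tree w))))%:E)%E.
Proof.
move=> h01.
(* Induction on the number l of factors that are arbitrary, the others being indicators of single
   trees. For l = 0 the integrand is the indicator of one tree of height n.+1, whose probability is
   its [weight]. *)
suff gen l : (l <= j)%N -> forall h : nat -> ttree n -> R,
    (forall i t, 0 <= h i t <= 1) ->
    (forall i, (l <= i < j)%N -> exists t, h i = fun s => (s == t)%:R) ->
    (\int[P]_w ((X [::] w == j)%:R * \prod_(i < j) h i (trunc n (child_tree (tree w) i)))%:E =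
   (p j * \prod_(i < j) Ex (fun w => h i (trunc n (tree w))))%:E)%E.
  by apply: (gen j) => // i; rewrite ltnNge => /andP[->].
have int1 (A : set T) : measurable A ->
    (\int[P]_w (\1_A w)%:E = P A)%E.
  by move=> mA; rewrite integral_indic// setIT.
have pt m t : P [set w | trunc m (tree w) = t] = (weight xi t)%:E.
  exact: (prob_trunc iidX [::]).
elim: l => [_|l IHl lj] {h01}h h01 hind.
  have [t ht] : exists t : nat -> ttree n, forall i, (i < j)%N -> h i = fun s => (s == t i)%:R.
    exists (fun i => if pselect (exists t, h i = fun s => (s == t)%:R) is left e
      then projT1 (cid e) else trunc n (fun=> 0%N)) => i ij.
    by case: pselect => [e|[]]; [case: (cid e)|exact: hind].
  pose s : ttree n.+1 := mkseq t j.
  transitivity (\int[P]_w (\1_[set w | trunc n.+1 (tree w) = s] w)%:E)%E.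
    apply: eq_integral => w _; congr EFin.
    under eq_bigr => i _ do rewrite ht//.
    rewrite indicE.
    have -> : (w \in [set w | trunc n.+1 (tree w) = s]) =
       (X [::] w == j) && [forall i : 'I_j, trunc n (child_tree (tree w) i) == t i].
      apply/idP/andP => [/set_mem/= e|[/eqP e /forallP H]].
        have e0 : X [::] w = j.
          by have := congr1 size e; rewrite size_map size_iota size_mkseq.
        split; first exact/eqP.
        apply/forallP => i; move: e; rewrite /s /mkseq /= /family_tree e0.
        move/eq_in_map => /(_ i); rewrite mem_iota/= => /(_ (ltn_ord i)) e.
        by rewrite -e.
      apply/mem_set; rewrite /s /mkseq /= /family_tree e.
      apply/eq_in_map => i; rewrite mem_iota/= => ij.
      exact/eqP/(H (Ordinal ij)).
    case: eqP => //= e; rewrite ?mul0r// mul1r.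
    case: forallP => [H|/forallP].
      by rewrite big1// => i _; rewrite H.
    rewrite negb_forall => /existsP[i /negbTE H].
    by rewrite (bigD1 i)//= H mul0r.
  rewrite int1; last exact: (mtrunc [::]).
  rewrite pt; congr EFin; rewrite /= size_mkseq.
  rewrite big_map -(big_mkord xpredT (fun i => Ex (fun w => h i (trunc n (tree w))))).
  rewrite /index_iota subn0; congr (_ * _); rewrite big_seq [RHS]big_seq.
  apply: eq_bigr => i; rewrite mem_iota => /= ij; rewrite ht//.
  rewrite /Ex -[weight _ _]/(fine (weight _ _)%:E) -pt -int1; last exact: (mtrunc [::]).
  by congr fine; apply: eq_integral => w _; rewrite indic_fiber.
have mcode : forall t, measurable [set w | trunc n (tree w) = t] := mtrunc (n := n) [::].
have msh i t : measurable [set w | trunc n (child_tree (tree w) i) = t] := mtrunc (n := n) [:: i] t.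
have V01 (g : nat -> ttree n -> R) (g01 : forall i t, 0 <= g i t <= 1) w :
    0 <= (X [::] w == j)%:R * \prod_(i < j) g i (trunc n (child_tree (tree w) i)) <= 1.
  have h1 : 0 <= \prod_(i < j) g i (trunc n (child_tree (tree w) i)) <= 1.
    by rewrite prodr_ge0/= ?prodr_ile1// => i _; case/andP: (g01 i (trunc n (child_tree (tree w) i))).
  by case: eqP => _; rewrite ?mul1r// mul0r lexx ler01.
have mV := measurable_root_children j.
have hl01 w : 0 <= h l (trunc n (tree w)) <= 1 by [].
pose lj' : 'I_j := Ordinal lj.
pose c := p j * \prod_(i < j | i != lj') Ex (fun w => h i (trunc n (tree w))).
have c0 : 0 <= c.
  rewrite mulr_ge0 ?fine_ge0 ?prodr_ge0// => i _; apply: fine_ge0.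
  by apply: integral_ge0 => w _; rewrite lee_fin; case/andP: (h01 i (trunc n (tree w))).
have mhl : measurable_fun setT (fun w => h l (trunc n (tree w))).
  by apply: (measurable_fun_trunc (n := n)) => w w' ->.
transitivity (\int[P]_w (c * h l (trunc n (tree w)))%:E)%E; last first.
  under eq_integral do rewrite EFinM.
  rewrite ge0_integralZl_EFin//; last 2 first.
    by move=> w _; rewrite lee_fin; case/andP: (hl01 w).
    exact/measurable_EFinP.
  rewrite -[X in (_ * X)%E]fineK; last exact: integral_unit_fin.
  rewrite -EFinM /c -mulrA; congr (_ * _)%:E.
  by rewrite [RHS](bigD1 lj')//= mulrC.
apply: (eq_integral_fibers (msh l) mcode).
- by move=> w; case/andP: (V01 h h01 w).
- by move=> w; rewrite mulr_ge0//; case/andP: (hl01 w).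
- exact: mV.
- exact: measurable_funM.
(* Where child tree l equals a, the factor [h l] is the constant [h l a]. Replacing it by the
   indicator of a leaves one arbitrary factor fewer, and the induction hypothesis applies. *)
move=> a; pose ha i := if i == l then (fun s => (s == a)%:R) else h i.
have ha01 i t : 0 <= ha i t <= 1.
  rewrite /ha; case: eqP => // _; by case: eqP; rewrite ?lexx ?ler01.
have hla0 : 0 <= h l a by case/andP: (h01 l a).
have := IHl (ltnW lj) ha ha01.
have hain i : (l <= i < j)%N -> exists t, ha i = fun s => (s == t)%:R.
  rewrite /ha; case: eqP => [_|/eqP il]; first by exists a.
  by move=> /andP[li ij]; apply: hind; rewrite ij ltn_neqAle eq_sym il li.
move=> /(_ hain) Ha.
transitivity ((h l a)%:E * \int[P]_(w in [set w | trunc n (child_tree (tree w) l) = a])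
  ((X [::] w == j)%:R * \prod_(i < j) ha i (trunc n (child_tree (tree w) i)))%:E)%E.
  rewrite -ge0_integralZl_EFin//; last 2 first.
    by move=> w _; rewrite lee_fin; case/andP: (V01 ha ha01 w).
    by apply/measurable_EFinP; apply: measurable_funTS; apply: mV.
  apply: eq_integral => w /set_mem /= wa; rewrite -EFinM; congr EFin.
  rewrite [in LHS](bigD1 lj')//= [in RHS](bigD1 lj')//= wa {1}/ha eqxx eqxx mul1r.
  rewrite mulrCA; congr (_ * (_ * _)); apply: eq_bigr => i il.
  by rewrite /ha ifN.
transitivity ((h l a)%:E * \int[P]_w
  ((X [::] w == j)%:R * \prod_(i < j) ha i (trunc n (child_tree (tree w) i)))%:E)%E.
  congr (_ * _)%E; rewrite [LHS]integral_mkcond; apply: eq_integral => w _.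
  rewrite patchE; case: ifPn => // /negP wa.
  rewrite (bigD1 lj')//= {1}/ha eqxx.
  have /negbTE -> : trunc n (child_tree (tree w) l) != a by apply/eqP => /mem_set.
  by rewrite mul0r mulr0.
transitivity ((c * h l a)%:E * P [set w | trunc n (tree w) = a])%E; last first.
  rewrite -integral_cst//; apply: eq_integral => w /set_mem /= -> //.
rewrite Ha -[P _]fineK ?fin_num_measure// -!EFinM; congr EFin.
rewrite [in LHS](bigD1 lj')//= /c.
have -> : Ex (fun w => ha l (trunc n (tree w))) = fine (P [set w | trunc n (tree w) = a]).
  rewrite -int1//; congr fine; apply: eq_integral => w _.
  by rewrite /ha eqxx indic_fiber.
have -> : \prod_(i < j | i != lj') Ex (fun w => ha i (trunc n (tree w))) =
   \prod_(i < j | i != lj') Ex (fun w => h i (trunc n (tree w))).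
  by apply: eq_bigr => i il; rewrite /ha ifN.
by ring.
Qed.

End branching.

(** The second clause hands bounds on F over to g at every argument, as the bounds required by
    [integral_root_children] are uniform in the tree. *)
Lemma trunc_factor (n : nat) (A : Type) (F : offspring -> A) :
  (forall off off', trunc n off = trunc n off' -> F off = F off') ->
  exists2 g : ttree n -> A, forall off, g (trunc n off) = F off &
    forall t, exists off, g t = F off.
Proof.
move=> Floc; exists (fun t => F (xget (fun=> 0%N) [set off | trunc n off = t])).
  by move=> off; apply: Floc; exact: (@xgetPex _ (fun=> 0%N) [set off' | trunc n off' = trunc n off] (ex_intro _ off erefl)).
by move=> t; exists (xget (fun=> 0%N) [set off | trunc n off = t]).
Qed.

(** Multiplying the bound for n by r exceeds the bound for n + 1 by n q^(n-1) (r - q)^2. Integrated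
    over [xi] it yields convexity of the generating function; at q = 1 it is Bernoulli's
    inequality. *)
Lemma exprn_support_line (R : realDomainType) (n : nat) (q r : R) : 0 <= q -> 0 <= r ->
  q ^+ n + n%:R * q ^+ n.-1 * (r - q) <= r ^+ n.
Proof.
move=> q0 r0; elim: n => [|n IHn]; first by rewrite !mul0r addr0.
have h : q ^+ n.+1 + n.+1%:R * q ^+ n * (r - q) <=
    r * (q ^+ n + n%:R * q ^+ n.-1 * (r - q)).
  case: n {IHn} => [|n] /=; first by rewrite !mul0r !expr1 expr0; lra.
  rewrite -subr_ge0 (_ : _ - _ = n.+1%:R * q ^+ n * (r - q) ^+ 2); last first.
    by rewrite !exprS; ring.
  by rewrite mulr_ge0 ?sqr_ge0// mulr_ge0 ?ler0n// exprn_ge0.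
by apply: le_trans h _; rewrite [leRHS]exprS ler_wpM2l.
Qed.

(** * Convexity of the generating function *)

Section generating_function.
Context (R : realType) (d : measure_display) (T : measurableType d)
  (P : probability T R) (xi : {RV P >-> nat}).

Let f := pgf xi.

Lemma measurable_fun_nat (g : nat -> R) (Y : {RV P >-> nat}) :
  measurable_fun setT (g \o Y).
Proof. by apply: measurableT_comp => //. Qed.

Lemma pgf_integral (s : R) : 0 <= s <= 1 ->
  (f s)%:E = (\int[P]_w (s ^+ xi w)%:E)%E.
Proof.
move=> /andP[s0 s1]; rewrite /f /pgf unlock fineK//.
apply: integral_unit_fin => //; first exact: (measurable_fun_nat (fun k => s ^+ k)).
by move=> w; rewrite exprn_ge0 ?exprn_ile1.
Qed.

Lemma pgf_itv (s : R) : 0 <= s <= 1 -> 0 <= f s <= 1.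
Proof.
move=> s01; rewrite -!lee_fin pgf_integral//; case/andP: s01 => s0 s1; apply/andP; split.
  by apply: integral_ge0 => w _; rewrite lee_fin exprn_ge0.
rewrite -(@probability_setT _ _ _ P) -[leRHS]mul1e -integral_cst//.
apply: ge0_le_integral => //.
- by move=> w _; rewrite lee_fin exprn_ge0.
- by apply/measurable_EFinP; exact: (measurable_fun_nat (fun k => s ^+ k)).
- by move=> w _; rewrite lee_fin exprn_ile1.
Qed.

Lemma iter_pgf_itv (n : nat) (s : R) : 0 <= s <= 1 -> 0 <= iter n f s <= 1.
Proof. by move=> s01; elim: n => //= n; apply: pgf_itv. Qed.

Hypothesis mean1 : ('E_P[fun w => (xi w)%:R : R] = 1)%E.

(** This is f'(s) as an expectation: conditioning on the root produces it in this form, and the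
    analysis uses it as the slope of a supporting line. *)
Definition dpgf (s : R) : R := fine (\int[P]_w ((xi w)%:R * s ^+ (xi w).-1)%:E)%E.

Lemma dpgf_integral (s : R) : 0 <= s <= 1 ->
  (dpgf s)%:E = (\int[P]_w ((xi w)%:R * s ^+ (xi w).-1)%:E)%E.
Proof.
move=> /andP[s0 s1]; rewrite /dpgf fineK// ge0_fin_numE; last first.
  by apply: integral_ge0 => w _; rewrite lee_fin mulr_ge0 ?exprn_ge0.
apply: (@le_lt_trans _ _ (\int[P]_w ((xi w)%:R : R)%:E)%E).
  apply: ge0_le_integral => //.
  - by move=> w _; rewrite lee_fin mulr_ge0 ?exprn_ge0.
  - by apply/measurable_EFinP; exact: (measurable_fun_nat (fun k => k%:R * s ^+ k.-1)).
  - by apply/measurable_EFinP; exact: (measurable_fun_nat (fun k => k%:R)).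
  - by move=> w _; rewrite lee_fin ler_piMr ?exprn_ile1.
by move: mean1; rewrite unlock => ->; rewrite ltry.
Qed.

Lemma dpgf_ge0 (s : R) : 0 <= s <= 1 -> 0 <= dpgf s.
Proof.
move=> s01; rewrite -lee_fin dpgf_integral//; case/andP: s01 => s0 s1.
by apply: integral_ge0 => w _; rewrite lee_fin mulr_ge0 ?exprn_ge0.
Qed.

Lemma pgf_support_line (s r : R) : 0 <= s <= 1 -> 0 <= r <= 1 ->
  f s + dpgf s * (r - s) <= f r.
Proof.
move=> s01 r01; have [s0 s1] := andP s01; have [r0 r1] := andP r01.
have me (q : R) : measurable_fun setT (fun w => (q ^+ xi w)%:E).
  by apply/measurable_EFinP; exact: (measurable_fun_nat (fun k => q ^+ k)).
have md : measurable_fun setT (fun w => ((xi w)%:R * s ^+ (xi w).-1)%:E : \bar R).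
  by apply/measurable_EFinP; exact: (measurable_fun_nat (fun k => k%:R * s ^+ k.-1)).
have d0 w : (0 <= ((xi w)%:R * s ^+ (xi w).-1)%:E)%E.
  by rewrite lee_fin mulr_ge0 ?exprn_ge0.
have mZ (c : R) : measurable_fun setT (fun w => c%:E * ((xi w)%:R * s ^+ (xi w).-1)%:E)%E.
  exact: measurable_funeM.
(* The sign of r - s decides on which side the slope term is put, so that only nonnegative functions
   are integrated. *)
rewrite -lee_fin; have [sr|rs] := leP s r.
  have sr0 : 0 <= r - s by rewrite subr_ge0.
  rewrite EFinD mulrC EFinM !pgf_integral// dpgf_integral// -ge0_integralZl_EFin//.
  rewrite -ge0_integralD//; last 2 first.
    by move=> w _; rewrite lee_fin exprn_ge0.
    by move=> w _; rewrite mule_ge0.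
  apply: ge0_le_integral => //.
  - by move=> w _; rewrite adde_ge0 ?mule_ge0// lee_fin exprn_ge0.
  - exact: emeasurable_funD.
  - move=> w _; rewrite -EFinM -EFinD lee_fin.
    by rewrite [X in _ + X]mulrC exprn_support_line.
have sr0 : 0 <= s - r by rewrite subr_ge0 ltW.
suff : ((f s)%:E <= (f r)%:E + ((s - r) * dpgf s)%:E)%E.
  by rewrite -EFinD !lee_fin; lra.
rewrite EFinM !pgf_integral// dpgf_integral// -ge0_integralZl_EFin//.
rewrite -ge0_integralD//; last 2 first.
  by move=> w _; rewrite lee_fin exprn_ge0.
  by move=> w _; rewrite mule_ge0.
apply: ge0_le_integral => //.
- by move=> w _; rewrite lee_fin exprn_ge0.
- exact: emeasurable_funD.
- move=> w _; rewrite -EFinM -EFinD lee_fin.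
  by have := exprn_support_line (xi w) s0 r0; lra.
Qed.

End generating_function.

(** * Generating function of Z(n) and the recursion for a single ancestor *)

Section branching_laws.
Context (R : realType) (d : measure_display) (T : measurableType d)
  (P : probability T R) (xi : {RV P >-> nat}) (X : seq nat -> {RV P >-> nat}).
Hypothesis iidX : iid_copies xi X.

Let f := pgf xi.
Local Notation tree := (family_tree X).
Local Notation p := (offspring_prob xi).

Lemma measurable_local (d' : measure_display) (T' : measurableType d') (n : nat)
    (V : offspring -> T') :
  (forall off off', trunc n off = trunc n off' -> V off = V off') ->
  measurable_fun setT (fun w => V (tree w)).
Proof.
by move=> Vloc; exact: (measurable_fun_trunc (X := X) (n := n) (fun w w' => Vloc _ _)).
Qed.

Lemma popsize_local (n m : nat) (off off' : offspring) : (m <= n)%N ->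
  trunc n off = trunc n off' -> popsize off m = popsize off' m.
Proof. by move=> mn /(trunc_generation mn); rewrite /popsize => ->. Qed.

Lemma reduced_popsize_local (n m : nat) (off off' : offspring) : (m <= n)%N ->
  trunc n off = trunc n off' -> reduced_popsize off m n = reduced_popsize off' m n.
Proof.
move=> mn e; rewrite /reduced_popsize (trunc_generation mn e).
by rewrite (trunc_generation (leqnn n) e).
Qed.

(** G j stands for the conditional mean of V given j children of the root; the last hypothesis says
    this without dividing by [p j], which may be 0. *)
Lemma integral_by_root (n : nat) (V : offspring -> R) (G : nat -> R) :
  (forall off off', trunc n off = trunc n off' -> V off = V off') ->
  (forall off, 0 <= V off) -> (forall j, 0 <= G j) ->
  (forall j, \int[P]_w ((X [::] w == j)%:R * V (tree w))%:E = (p j * G j)%:E)%E ->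
  (\int[P]_w (V (tree w))%:E = \int[P]_w (G (xi w))%:E)%E.
Proof.
move=> Vloc V0 G0 VG.
have mfib (Y : {RV P >-> nat}) j : measurable [set w | Y w = j].
  exact: (@measurable_funPTI _ _ _ _ Y [set j]).
apply: (@eq_integral_fibers _ _ _ nat P (X [::]) xi) => //.
- exact: measurable_local Vloc.
- exact: measurable_fun_nat.
move=> j; transitivity (p j * G j)%:E.
  rewrite -VG [LHS]integral_mkcond; apply: eq_integral => w _.
  rewrite patchE -(indic_fiber R (X [::])) indicE.
  by case: ifP; rewrite ?mul1r ?mul0r.
transitivity (\int[P]_(w in [set w | xi w = j]) (G j)%:E)%E.
  rewrite integral_cst// mulrC EFinM fineK// fin_num_measure//.
  exact: mfib.
by apply: eq_integral => w /set_mem /= ->.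
Qed.

Lemma integral_popsize (n : nat) (s : R) : 0 <= s <= 1 ->
  (\int[P]_w (s ^+ popsize (tree w) n)%:E = (iter n f s)%:E)%E.
Proof.
move=> s01; have [s0 s1] := andP s01; elim: n => [|n IHn].
  rewrite (eq_integral (cst s%:E)) => [|w _]; last by rewrite /popsize/= expr1.
  by rewrite integral_cst//= probability_setT mule1.
have loc m off off' : trunc m off = trunc m off' ->
    s ^+ popsize off m = s ^+ popsize off' m.
  by move=> /(popsize_local (leqnn m)) ->.
rewrite [iter _ _ _]/= pgf_integral ?iter_pgf_itv//.
apply: (@integral_by_root n.+1 (fun off => s ^+ popsize off n.+1) (fun j => (iter n f s) ^+ j)) => //.
- exact: loc.
- by move=> off; rewrite exprn_ge0.
- by move=> j; rewrite exprn_ge0//; case/andP: (iter_pgf_itv xi n s01).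
have [g gE gV] := trunc_factor (loc n).
move=> j; have := integral_root_children iidX j (h := fun=> g).
have g01 : forall (_ : nat) t, 0 <= g t <= 1.
  by move=> _ t; have [off ->] := gV t; rewrite exprn_ge0 ?exprn_ile1.
move=> /(_ g01); under [X in (_ = (_ * X)%:E)%E -> _]eq_bigr => i _.
  under eq_integral do rewrite gE.
  rewrite IHn; over.
rewrite prodr_const card_ord => <-; apply: eq_integral => w _; congr EFin.
case: eqP => [e|]; rewrite ?mul0r// !mul1r popsizeS [tree w [::]]e -prodrXr.
by apply: eq_bigr => i _; rewrite gE.
Qed.

Lemma prob_extinct (n : nat) :
  (\int[P]_w ((popsize (tree w) n == 0%N)%:R : R)%:E = (iter n f 0)%:E)%E.
Proof.
by rewrite -integral_popsize ?lexx ?ler01//; apply: eq_integral => w _; rewrite expr0n.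
Qed.

Definition one_ancestor (pr : pred nat) (m n : nat) (off : offspring) : bool :=
  (reduced_popsize off m n == 1%N) && pr (popsize off n).

Lemma one_ancestor_local (pr : pred nat) (m n : nat) (off off' : offspring) :
  (m <= n)%N -> trunc n off = trunc n off' ->
  one_ancestor pr m n off = one_ancestor pr m n off'.
Proof.
move=> mn e; rewrite /one_ancestor (reduced_popsize_local mn e).
by rewrite (popsize_local (leqnn n) e).
Qed.

(** Exactly one child of the root has a surviving line, and its tree carries the event of
    probability A; each of the j - 1 others is extinct with probability q = f_n(0). Summing over the
    surviving child gives j q^(j-1) A, whose mean over j is f'(q) A. *)
Lemma integral_one_ancestor (pr : pred nat) (m n : nat) (A : R) : (m <= n)%N -> ~~ pr 0%N ->
  (\int[P]_w ((one_ancestor pr m n (tree w))%:R : R)%:E = A%:E)%E ->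
  ('E_P[fun w => (xi w)%:R : R] = 1)%E ->
  (\int[P]_w ((one_ancestor pr m.+1 n.+1 (tree w))%:R : R)%:E =
   (dpgf xi (iter n f 0) * A)%:E)%E.
Proof.
move=> mn pr0 EA mean1.
have q01 : 0 <= iter n f 0 <= 1 by apply: iter_pgf_itv; rewrite lexx ler01.
have [q0 q1] := andP q01; set q := iter n f 0 in q0 q1 q01 *.
have A0 : 0 <= A by rewrite -lee_fin -EA integral_ge0// => w _; rewrite lee_fin.
transitivity (\int[P]_w ((xi w)%:R * q ^+ (xi w).-1 * A)%:E)%E; last first.
  rewrite mulrC EFinM dpgf_integral// -ge0_integralZl_EFin//.
  - by apply: eq_integral => w _; rewrite -EFinM mulrC.
  - by move=> w _; rewrite lee_fin mulr_ge0 ?exprn_ge0.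
  - by apply/measurable_EFinP; exact: (measurable_fun_nat (fun k => k%:R * q ^+ k.-1)).
apply: (@integral_by_root n.+1 (fun off => (one_ancestor pr m.+1 n.+1 off)%:R)
  (fun j => j%:R * q ^+ j.-1 * A)) => //.
- by move=> off off' /one_ancestor_local ->.
- by move=> j; rewrite !mulr_ge0 ?exprn_ge0.
have [g gE gV] : exists2 g : ttree n -> R,
    forall off, g (trunc n off) = (one_ancestor pr m n off)%:R & forall t, 0 <= g t <= 1.
  have [|g gE gV] := @trunc_factor n R (fun off => (one_ancestor pr m n off)%:R).
    by move=> off off' /one_ancestor_local ->.
  by exists g => // t; have [off ->] := gV t; rewrite ler0n lern1 leq_b1.
have [z zE zV] : exists2 z : ttree n -> R,
    forall off, z (trunc n off) = (popsize off n == 0%N)%:R & forall t, 0 <= z t <= 1.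
  have [|z zE zV] := @trunc_factor n R (fun off => (popsize off n == 0%N)%:R).
    by move=> off off' /(popsize_local (leqnn n)) ->.
  by exists z => // t; have [off ->] := zV t; rewrite ler0n lern1 leq_b1.
move=> j.
pose h (i l : nat) := if l == i then g else z.
have h01 i l t : 0 <= h i l t <= 1 by rewrite /h; case: eqP.
transitivity (\int[P]_w (\sum_(i < j) ((X [::] w == j)%:R *
    \prod_(l < j) h i l (trunc n (child_tree (tree w) l)))%:E))%E.
  apply: eq_integral => w _; rewrite sumEFin -mulr_sumr.
  case: eqP => [e|]; rewrite ?mul0r// !mul1r; congr EFin.
  rewrite /one_ancestor reduced_popsizeS popsizeS [tree w [::]]e.
  rewrite (sum_eq1_prod (p := pr) (r := fun i : 'I_j => reduced_popsize (child_tree (tree w) i) m n)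
    (z := fun i : 'I_j => popsize (child_tree (tree w) i) n))//; last first.
    by move=> i; apply: reduced_popsize_eq0.
  rewrite natr_sum; apply: eq_bigr => i _; rewrite natr_prod; apply: eq_bigr => l _.
  by rewrite /h -[(l : nat) == i]/(l == i); case: eqP => _; rewrite ?gE ?zE.
rewrite ge0_integral_sum//; last 2 first.
  by move=> i; apply/measurable_EFinP; apply: measurable_root_children.
  move=> i w _; rewrite lee_fin mulr_ge0// prodr_ge0// => l _.
  by case/andP: (h01 i l (trunc n (child_tree (tree w) l))).
rewrite (eq_bigr (fun=> (p j * (q ^+ j.-1 * A))%:E)) => [|i _].
  by rewrite sumEFin sumr_const card_ord; congr EFin; rewrite -mulr_natl; ring.
rewrite (integral_root_children iidX j (h := h i))//; congr ((_ * _)%:E).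
rewrite (bigD1 i)//= mulrC; congr (_ * _).
  rewrite (eq_bigr (fun=> q)) => [|l li].
    rewrite prodr_const; congr (_ ^+ _).
    by rewrite cardC1 card_ord.
  rewrite /h ifN//; under eq_integral do rewrite zE.
  by rewrite prob_extinct.
rewrite /h eqxx; under eq_integral do rewrite gE.
by rewrite EA.
Qed.

End branching_laws.

(** * Iterates of a critical generating function *)

Lemma cvgr_bounds (R : realType) (u : nat -> R) (l : R) :
  (forall e, 0 < e -> \forall n \near \oo, l - e <= u n) ->
  (forall e, 0 < e -> \forall n \near \oo, u n <= l + e) ->
  u n @[n --> \oo] --> l.
Proof.
move=> lo hi; apply/cvgrPdist_le => e e0.
near=> n; rewrite ler_distlC; apply/andP; split; near: n; [exact: lo|exact: hi].
Unshelve. all: by end_near. Qed.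

(** With p = 1 + alpha these quotients are the limits of the normalised secant slopes of G to the
    right and to the left of Q(n) in [slope_ratio]. *)
Lemma powR_diff_quotient (R : realType) (p e : R) : 0 < e ->
  exists2 h, 0 < h < 1 & ((1 + h) `^ p - 1) / h <= p + e /\
                        p - e <= (1 - (1 - h) `^ p) / h.
Proof.
move=> e0.
have [dp ep] : is_derive (1 : R) 1 (fun x => x `^ p) (p * 1 `^ (p - 1)).
  exact: is_derive1_powR.
move: ep; rewrite powR1 mulr1 /derive => ep.
have cv : (fun h => h^-1 *: (((h *: (1 : R) + 1) `^ p) - 1 `^ p)) h @[h --> (0 : R)^'] --> p.
  by rewrite -[X in _ --> X]ep; exact: dp.
have /cvgrPdist_le/(_ _ e0) [r /= r0 H] := cv.
exists (Num.min (r / 2) 2^-1).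
  by rewrite lt_min gt_min divr_gt0//= invr_gt0 ltr0n /= orbC invf_lt1 ?ltr1n.
set h := Num.min _ _.
have h0 : 0 < h by rewrite lt_min divr_gt0//= invr_gt0 ltr0n.
have hr : h < r by rewrite gt_min ltr_pdivrMr// ltr_pMr// ltr1n.
have quotE k : k^-1 *: ((k *: 1 + 1) `^ p - 1 `^ p) = ((1 + k) `^ p - 1) / k.
  by rewrite powR1 /GRing.scale/= mulr1 (addrC k) mulrC.
have absE k : `|k| = h -> `|p - ((1 + k) `^ p - 1) / k| <= e.
  move=> kh; rewrite -quotE; apply: H; first by rewrite /ball/= sub0r normrN kh.
  by rewrite -normr_gt0 kh.
split.
  by have := absE h (gtr0_norm h0); rewrite ler_distlC => /andP[].
have := absE (- h); rewrite normrN => /(_ (gtr0_norm h0)).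
by rewrite ler_distlC invrN mulrN -mulNr opprB => /andP[].
Qed.

Lemma truncn_cvg_ratio (R : realType) (c : R) (phi : nat -> R) : 0 < c ->
  phi n @[n --> \oo] --> +oo ->
  (Num.truncn (c * phi n))%:R / phi n @[n --> \oo] --> c.
Proof.
move=> c0 phioo; apply: cvgr_bounds => e e0.
  near=> n; have p0 : 0 < phi n by near: n; move/cvgryPgt: phioo; apply.
  have pe : e^-1 <= phi n by near: n; move/cvgryPge: phioo; apply.
  have cp : 0 <= c * phi n by rewrite ltW// mulr_gt0.
  have /andP[_ h] := truncn_itv cp.
  rewrite ler_pdivlMr// mulrBl lerBlDr (le_trans (ltW h))// -natr1 lerD2l.
  by rewrite mulrC -ler_pdivrMr// div1r.
near=> n; have p0 : 0 < phi n by near: n; move/cvgryPgt: phioo; apply.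
have cp : 0 <= c * phi n by rewrite ltW// mulr_gt0.
have /andP[h _] := truncn_itv cp.
by rewrite ler_pdivrMr// (le_trans h)// mulrDl lerDl mulr_ge0// ltW.
Unshelve. all: by end_near. Qed.

Lemma truncn_cvgy (R : realType) (c : R) (phi : nat -> R) : 0 < c ->
  phi n @[n --> \oo] --> +oo -> Num.truncn (c * phi n) @[n --> \oo] --> \oo.
Proof.
move=> c0 phioo; apply/cvgnyPge => N; near=> n.
have h : N%:R <= c * phi n.
  rewrite mulrC -ler_pdivrMr//; near: n; move/cvgryPge: phioo; apply.
by rewrite truncn_ge_nat// (le_trans _ h).
Unshelve. all: by end_near. Qed.

(** Made for the comparison of exp(-lam Q) with iterates f_j(0): it is available only for parameters
    c strictly on one side of y = lam^(-alpha), and continuity of H lets c tend to y. *)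
Lemma cvgr_interval (R : realType) (u : nat -> R) (y : R) (H : R -> R) : 0 < y ->
  {for y, continuous H} ->
  (forall c e, 0 < c < y -> 0 < e -> \forall n \near \oo, H c - e <= u n) ->
  (forall c e, y < c -> 0 < e -> \forall n \near \oo, u n <= H c + e) ->
  u n @[n --> \oo] --> H y.
Proof.
move=> y0 cH lo hi; apply: cvgr_bounds => e e0.
  have e2 : 0 < e / 2 by rewrite divr_gt0.
  have /cvgrPdist_le/(_ _ e2) [r /= r0 B] := cH.
  pose c := Num.max (y - r / 2) (y / 2).
  have c0 : 0 < c by rewrite lt_max divr_gt0 ?orbT.
  have cy : c < y.
    by rewrite gt_max gtrBl divr_gt0//= ltr_pdivrMr// ltr_pMr// ltr1n.
  have rc : y - r < c.
    by rewrite lt_max ltrD2l ltrN2 ltr_pdivrMr// ltr_pMr// ltr1n.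
  have Bc : `|y - c| < r by rewrite gtr0_norm ?subr_gt0//; lra.
  have := B c Bc; rewrite ler_distlC => /andP[h _].
  have := lo c (e / 2); rewrite c0 cy => /(_ isT e2).
  by apply: filterS => n; lra.
have e2 : 0 < e / 2 by rewrite divr_gt0.
have /cvgrPdist_le/(_ _ e2) [r /= r0 B] := cH.
pose c := y + r / 2.
have cy : y < c by rewrite ltrDl divr_gt0.
have Bc : `|y - c| < r.
  by rewrite /c opprD addrA subrr sub0r normrN gtr0_norm ?divr_gt0// ltr_pdivrMr// ltr_pMr// ltr1n.
have := B c Bc; rewrite ler_distlC => /andP[_ h].
have := hi c (e / 2) cy e2.
by apply: filterS => n; lra.
Qed.

(** * Regular variation of the survival probabilities *)

Section critical_iteration.
Context (R : realType) (f df L : R -> R) (alpha : R).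
Hypothesis alpha_gt0 : 0 < alpha.
Hypothesis f_itv : forall s : R, 0 <= s <= 1 -> 0 <= f s <= 1.
Hypothesis df_ge0 : forall s : R, 0 <= s <= 1 -> 0 <= df s.
Hypothesis f_support : forall s r : R, 0 <= s <= 1 -> 0 <= r <= 1 ->
  f s + df s * (r - s) <= f r.
Hypothesis svL : slowly_varying_at0 L.
Hypothesis fE : forall s : R, 0 <= s <= 1 ->
  f s = s + (1 - s) `^ (1 + alpha) * L (1 - s).

(** This is G(z)/z. Along the orbit it is the relative loss 1 - Q(n+1)/Q(n), that is,
    gap(n)/Q(n). *)
Definition ell (z : R) : R := z `^ alpha * L z.
Local Notation G z := (z * ell z).
Definition surv (n : nat) : R := 1 - iter n f 0.
Local Notation Q := surv.

Lemma gapE z : 0 <= z <= 1 -> f (1 - z) = 1 - z + G z.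
Proof.
move=> /andP[z0 z1]; rewrite fE ?subKr; last by rewrite subr_ge0 z1 gerBl.
rewrite powRD ?powRr1// /ell; first by rewrite mulrA.
by rewrite gt_eqF// addr_gt0.
Qed.

Lemma ell_gt0 z : 0 < z <= 1 -> 0 < ell z.
Proof.
by case: svL => Lp _ _ z01; rewrite mulr_gt0 ?Lp// powR_gt0//; case/andP: z01.
Qed.

Lemma gap_support a b : 0 <= a <= 1 -> 0 <= b <= 1 ->
  G a + (1 - df (1 - a)) * (b - a) <= G b.
Proof.
move=> a01 b01; have o01 (z : R) : 0 <= z <= 1 -> 0 <= 1 - z <= 1 by move=> ?; lra.
have := f_support (o01 _ a01) (o01 _ b01); rewrite !gapE//.
by set D := df _; lra.
Qed.

(** The slope of the supporting line of G at b separates the two secants. *)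
Lemma gap_slopes a b c : 0 <= a -> a < b -> b < c -> c <= 1 ->
  (G b - G a) / (b - a) <= (G c - G b) / (c - b).
Proof.
move=> a0 ab bc c1.
have b01 : 0 <= b <= 1 by lra.
have a01 : 0 <= a <= 1 by lra.
have c01 : 0 <= c <= 1 by lra.
have ha := gap_support b01 a01; have hc := gap_support b01 c01.
apply: (@le_trans _ _ (1 - df (1 - b))).
  by rewrite ler_pdivrMr ?subr_gt0//; lra.
by rewrite ler_pdivlMr ?subr_gt0//; lra.
Qed.

Lemma ell_ratio (c : R) : 0 < c ->
  ell (c * z) / ell z @[z --> 0^'+] --> c `^ alpha.
Proof.
move=> c0; case: svL => Lp _ Lsv.
have H : c `^ alpha * (L (c * z) / L z) @[z --> 0^'+] --> c `^ alpha.
  by rewrite -[X in _ --> X]mulr1; apply: cvgMr; exact: Lsv.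
apply: cvg_trans H; apply: near_eq_cvg.
near=> z.
have z0 : 0 < z by near: z; exact: nbhs_right_gt.
have z1 : z <= 1 by near: z; apply: nbhs_right_le; exact: ltr01.
rewrite /ell powRM ?(ltW c0) ?(ltW z0)// invfM.
have za : z `^ alpha != 0 by rewrite gt_eqF// powR_gt0.
have Lz : L z != 0 by rewrite gt_eqF// Lp// z0.
by field; rewrite Lz za.
Unshelve. all: by end_near. Qed.

(** [ell z] is the slope of the secant of the convex function G from 0, where G vanishes. *)
Lemma ell_nondecreasing a b : 0 < a -> a <= b -> b <= 1 -> ell a <= ell b.
Proof.
move=> a0; rewrite le_eqVlt => /predU1P[->//|ab] b1.
have := @gap_slopes 0 a b (lexx _) a0 ab b1.
rewrite mul0r !subr0 mulrC mulKf ?gt_eqF// ler_pdivlMr ?subr_gt0// => h.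
have b0 : 0 < b by lra.
by rewrite -(ler_pM2l b0); lra.
Qed.

(** Near 0 each halving of z multiplies [ell z] by less than some u < 1, because the limiting ratio
    2^(-alpha) is below 1. Monotonicity carries the bound from one point of this geometric sequence
    to all smaller z. *)
Lemma ell_small (e : R) : 0 < e ->
  exists2 r, 0 < r <= 1 & forall z, 0 < z <= r -> ell z < e.
Proof.
move=> e0; have h0 : 0 < (2^-1 : R) by rewrite invr_gt0 ltr0n.
pose t : R := 2^-1 `^ alpha.
have t0 : 0 < t by exact: powR_gt0.
have t1 : t < 1.
  have <- : (1 : R) `^ alpha = 1 by rewrite powR1.
  by rewrite gt0_ltr_powR// ?nnegrE ?ler01 ?ltW// invf_lt1 ?ltr1n.
pose u := (1 + t) / 2.
have tu : t < u by rewrite ltr_pdivlMr//; lra.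
have u0 : 0 < u by rewrite /u divr_gt0// addr_gt0.
have u1 : u < 1 by rewrite /u ltr_pdivrMr//; lra.
have [r0 /= r0_gt0 H] : \forall z \near 0^'+, ell (2^-1 * z) / ell z < u.
  exact: (cvgr_lt _ (ell_ratio h0)).
pose r := Num.min (r0 / 2) 1.
have rp : 0 < r by rewrite lt_min divr_gt0//=.
have r1 : r <= 1 by rewrite ge_min lexx orbT.
have rr0 : r < r0 by rewrite gt_min ltr_pdivrMr// ltr_pMr// ltr1n.
have geo k : ell (2^-1 ^+ k * r) <= u ^+ k * ell r.
  elim: k => [|k IHk]; first by rewrite !expr0 !mul1r.
  have z0 : 0 < 2^-1 ^+ k * r by rewrite mulr_gt0 ?exprn_gt0.
  have zr : 2^-1 ^+ k * r <= r.
    by rewrite ler_piMl ?(ltW rp)// exprn_ile1 ?(ltW h0)// invf_le1 ?ler1n.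
  have el0 : 0 < ell (2^-1 ^+ k * r) by apply: ell_gt0; lra.
  have := H (2^-1 ^+ k * r).
  rewrite /ball/= sub0r normrN gtr0_norm// => /(_ (le_lt_trans zr rr0) z0).
  rewrite ltr_pdivrMr// => /ltW; rewrite mulrA -exprS => /le_trans -> //.
  by rewrite exprS -mulrA ler_wpM2l ?(ltW u0).
have er0 : 0 < ell r by apply: ell_gt0; rewrite rp r1.
have [k uk] : exists k, u ^+ k * ell r < e.
  have : u ^+ k @[k --> \oo] --> (0 : R) by apply: cvg_expr; rewrite gtr0_norm.
  move=> /(cvgr_lt _)/(_ (e / ell r)); rewrite divr_gt0// => /(_ isT)[k _ /(_ k (leqnn k))].
  by rewrite /= ltr_pdivlMr// => ?; exists k.
have z0 : 0 < 2^-1 ^+ k * r by rewrite mulr_gt0 ?exprn_gt0.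
have zr : 2^-1 ^+ k * r <= r.
  by rewrite ler_piMl ?(ltW rp)// exprn_ile1 ?(ltW h0)// invf_le1 ?ler1n.
exists (2^-1 ^+ k * r); first by rewrite z0 (le_trans zr).
move=> z /andP[zp zle]; apply: le_lt_trans uk; apply: le_trans (geo k).
by apply: ell_nondecreasing => //; apply: le_trans r1.
Qed.

Lemma f_le s r : 0 <= s -> s <= r -> r <= 1 -> f s <= f r.
Proof.
move=> s0 sr r1; have s01 : 0 <= s <= 1 by lra.
have r01 : 0 <= r <= 1 by lra.
apply: le_trans (f_support s01 r01).
by rewrite lerDl mulr_ge0 ?df_ge0// subr_ge0.
Qed.

(** Equivalent to f(s) < 1 for s < 1, so Q(n) never reaches 0. Near s = 1 it holds because [ell] is
    small, and further left because f is nondecreasing. *)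
Lemma ell_lt1 z : 0 < z <= 1 -> ell z < 1.
Proof.
move=> /andP[z0 z1]; have [r /andP[r0 r1] /(_ (Num.min r z)) h] := ell_small (@ltr01 R).
have m0 : 0 < Num.min r z by rewrite lt_min r0.
have mz : Num.min r z <= z by rewrite ge_min lexx orbT.
have {}h : ell (Num.min r z) < 1 by apply: h; rewrite m0 ge_min lexx.
set m := Num.min r z in m0 mz h *.
have z01 : 0 <= z <= 1 by lra.
have m01 : 0 <= m <= 1 by lra.
have fm : f (1 - m) < 1.
  have mm : m * ell m < m by rewrite gtr_pMr.
  by rewrite gapE//; lra.
have : f (1 - z) <= f (1 - m) by apply: f_le; lra.
rewrite (gapE z01) => h2.
have : z * ell z < z * 1 by rewrite mulr1; lra.
by rewrite ltr_pM2l.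
Qed.

Lemma survS_itv n : 0 < Q n <= 1 ->
  Q n.+1 = Q n - Q n * ell (Q n) /\ 0 < Q n.+1 <= 1.
Proof.
move=> Qn; have [q0 q1] := andP Qn.
have e : Q n.+1 = Q n - Q n * ell (Q n).
  have Qn' : 0 <= Q n <= 1 by lra.
  have fi : iter n f 0 = 1 - Q n by rewrite /surv subKr.
  rewrite {1}/surv iterS fi gapE//; lra.
split=> //; rewrite e; apply/andP; split.
  by rewrite subr_gt0 gtr_pMr// ell_lt1.
have : 0 < Q n * ell (Q n) by rewrite mulr_gt0 ?ell_gt0.
by lra.
Qed.

Lemma surv_itv n : 0 < Q n <= 1.
Proof.
elim: n => [|n IHn]; first by rewrite /surv /= subr0 ltr01 lexx.
by case: (survS_itv IHn).
Qed.

Lemma survS n : Q n.+1 = Q n - Q n * ell (Q n).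
Proof. by case: (survS_itv (surv_itv n)). Qed.

Lemma surv_gt0 n : 0 < Q n. Proof. by case/andP: (surv_itv n). Qed.
Lemma surv_le1 n : Q n <= 1. Proof. by case/andP: (surv_itv n). Qed.

Lemma surv_nonincreasing m n : (m <= n)%N -> Q n <= Q m.
Proof.
move=> /subnK <-; elim: (n - m)%N => // k IHk.
rewrite addSn; apply: le_trans IHk; rewrite survS gerBl.
by rewrite mulr_ge0 ?(ltW (surv_gt0 _))// ltW// ell_gt0// surv_itv.
Qed.

(** If Q(n) stayed above e, each step would subtract at least G(e) > 0 and Q would become
    negative. *)
Lemma surv_cvg0 : Q n @[n --> \oo] --> (0 : R).
Proof.
apply: cvgr_bounds => e e0.
  by apply: nearW => n /=; rewrite sub0r (le_trans _ (ltW (surv_gt0 n)))// oppr_le0 ltW.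
rewrite add0r.
have [n0 n0e] : exists n, Q n <= e.
  apply/not_existsP => H.
  have {}H n : e < Q n by rewrite ltNge; apply/negP/H.
  have e1 : e <= 1 by apply: le_trans (ltW (H 0%N)) (surv_le1 0).
  have ee : 0 < e * ell e by rewrite mulr_gt0 ?ell_gt0// e0.
  have dec n : Q n <= 1 - n%:R * (e * ell e).
    elim: n => [|n IHn]; first by rewrite mul0r subr0 surv_le1.
    rewrite survS -natr1 [(_ + 1) * _]mulrDl mul1r.
    have : e * ell e <= Q n * ell (Q n).
      rewrite ler_pM ?(ltW e0) ?(ltW (H n))//; first by rewrite ltW// ell_gt0// e0.
      by apply: ell_nondecreasing => //; [exact/ltW/H|exact: surv_le1].
    by move=> h; rewrite opprD addrA lerB.
  have [N hN] : exists N : nat, 1 < N%:R * (e * ell e).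
    exists (Num.truncn (1 / (e * ell e))).+1.
    by rewrite -ltr_pdivrMr// truncnS_gt.
  by have := dec N; have := surv_gt0 N; lra.
near=> n; apply: le_trans n0e; apply: surv_nonincreasing.
by near: n; exists n0.
Unshelve. all: by end_near. Qed.

Lemma ell_ratio_seq (c : R) (k : nat -> nat) : 0 < c -> k n @[n --> \oo] --> \oo ->
  ell (c * Q (k n)) / ell (Q (k n)) @[n --> \oo] --> c `^ alpha.
Proof.
move=> c0 koo; have /cvg_at_rightP/(_ (fun n => Q (k n))) := ell_ratio c0; apply.
split=> [n|]; first exact: surv_gt0.
exact: (cvg_comp _ _ koo surv_cvg0).
Qed.

Lemma ell_surv_cvg0 : ell (Q n) @[n --> \oo] --> (0 : R).
Proof.
have Q01 n : 0 < Q n <= 1 := surv_itv n.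
apply: cvgr_bounds => e e0.
  by apply: nearW => n; rewrite sub0r (le_trans _ (ltW (ell_gt0 (Q01 n))))// oppr_le0 ltW.
rewrite add0r; have [r /andP[r0 _] H] := ell_small e0.
near=> n; apply/ltW/H; rewrite surv_gt0/=; near: n.
exact: (cvgr_le _ surv_cvg0).
Unshelve. all: by end_near. Qed.

Lemma gap_slope_left a b c : 0 <= a -> a <= b -> b < c -> c <= 1 ->
  G c - G a <= (G c - G b) / (c - b) * (c - a).
Proof.
move=> a0; rewrite le_eqVlt => /predU1P[->|ab] bc c1.
  by rewrite divfK// gt_eqF// subr_gt0.
have := gap_slopes a0 ab bc c1; rewrite ler_pdivrMr ?subr_gt0// => h.
have cb0 : c - b != 0 by rewrite gt_eqF// subr_gt0.
have -> : c - a = (c - b) + (b - a) by ring.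
by rewrite mulrDr divfK//; lra.
Qed.

(* The slope of [z * ell z] between two consecutive survival probabilities; the
   increment of [1 / ell] is [(D / ell - 1) / (1 - D)]. *)
Let D n := (Q n * ell (Q n) - Q n.+1 * ell (Q n.+1)) / (Q n - Q n.+1).

(** By convexity [D n] lies between the secant slopes of G over [(1-h) Q(n), Q(n)] and
    [Q(n), (1+h) Q(n)]. Their ratios are fixed, so slow variation gives the limits of these slopes
    divided by [ell (Q n)]: difference quotients of z^(1+alpha) at 1. *)
Lemma slope_ratio : D n / ell (Q n) @[n --> \oo] --> 1 + alpha.
Proof.
have idoo : (fun n : nat => n) @ \oo --> \oo by [].
have a1 : (1 + alpha == 0) = false by rewrite gt_eqF// addr_gt0.
have powE (y : R) : 0 < y -> y `^ (1 + alpha) = y * y `^ alpha.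
  by move=> y0; rewrite powRD ?powRr1 ?(ltW y0)// a1.
have e2 (e : R) : 0 < e -> 0 < e / 2 by move=> ?; rewrite divr_gt0.
apply: cvgr_bounds => e e0; have [h /andP[h0 h1] [hhi hlo]] := powR_diff_quotient (1 + alpha) (e2 _ e0).
  have h1' : 0 < 1 - h by rewrite subr_gt0.
  have hc : (1 - (1 - h) * (ell ((1 - h) * Q n) / ell (Q n))) / h @[n --> \oo] -->
      (1 - (1 - h) `^ (1 + alpha)) / h.
    apply: cvgMl; apply: cvgB; first exact: cvg_cst.
    by rewrite powE//; apply: cvgMr; exact: (ell_ratio_seq h1' idoo).
  near=> n.
  have q0 := surv_gt0 n; have q1 := surv_le1 n; have l0 : 0 < ell (Q n) by rewrite ell_gt0// q0.
  (* This says Q(n+1) >= (1-h) Q(n): the long secant covers the short step. *)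
  have eh : ell (Q n) <= h by near: n; apply: (cvgr_le _ ell_surv_cvg0).
  have q'q : Q n.+1 < Q n by rewrite survS gtrBl mulr_gt0.
  have q'h : (1 - h) * Q n <= Q n.+1.
    by rewrite survS mulrBl mul1r lerB// mulrC ler_wpM2r// ltW.
  have := gap_slope_left (ltW (mulr_gt0 h1' q0)) q'h q'q q1; rewrite -/(D n).
  rewrite (_ : Q n - (1 - h) * Q n = h * Q n); last by ring.
  rewrite -ler_pdivrMr ?mulr_gt0// => hD.
  rewrite ler_pdivlMr//; apply: le_trans hD.
  rewrite -ler_pdivlMr//.
  rewrite (_ : _ / ell (Q n) = (1 - (1 - h) * (ell ((1 - h) * Q n) / ell (Q n))) / h); last first.
    by field; rewrite !gt_eqF.
  near: n; apply: (cvgr_ge _ hc); apply: lt_le_trans hlo.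
  by have := e2 _ e0; lra.
have h1' : 0 < 1 + h by rewrite addr_gt0.
have hc : ((1 + h) * (ell ((1 + h) * Q n) / ell (Q n)) - 1) / h @[n --> \oo] -->
    ((1 + h) `^ (1 + alpha) - 1) / h.
  apply: cvgMl; apply: cvgB; last exact: cvg_cst.
  by rewrite powE//; apply: cvgMr; exact: (ell_ratio_seq h1' idoo).
near=> n.
have q0 := surv_gt0 n; have q1 := surv_le1 n; have l0 : 0 < ell (Q n) by rewrite ell_gt0// q0.
have qh : (1 + h) * Q n <= 1.
  rewrite mulrC -ler_pdivlMr//; near: n; apply: (cvgr_le _ surv_cvg0).
  by rewrite divr_gt0.
have q'q : Q n.+1 < Q n by rewrite survS gtrBl mulr_gt0.
have qq : Q n < (1 + h) * Q n by rewrite ltr_pMl// ltrDl.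
have := gap_slopes (ltW (surv_gt0 n.+1)) q'q qq qh; rewrite -/(D n) => hD.
rewrite ler_pdivrMr//; apply: (le_trans hD).
rewrite -ler_pdivrMr//.
rewrite (_ : _ / ell (Q n) = ((1 + h) * (ell ((1 + h) * Q n) / ell (Q n)) - 1) / h); last first.
  field; rewrite !gt_eqF//=.
  by rewrite (_ : _ - _ = h * Q n) ?mulr_gt0//; ring.
near: n; apply: (cvgr_le _ hc); apply: le_lt_trans hhi _.
by have := e2 _ e0; lra.
Unshelve. all: by end_near. Qed.

Lemma inv_ell_increment : (ell (Q n.+1))^-1 - (ell (Q n))^-1 @[n --> \oo] --> alpha.
Proof.
have D0 : D n @[n --> \oo] --> (0 : R).
  rewrite -(mulr0 (1 + alpha)).
  apply: cvg_trans (cvgM slope_ratio ell_surv_cvg0); apply: near_eq_cvg.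
  by apply: nearW => n; rewrite /= divfK// gt_eqF// ell_gt0// surv_itv.
have : (D n / ell (Q n) - 1) / (1 - D n) @[n --> \oo] --> (1 + alpha - 1) / (1 - 0).
  apply: cvgM; first by apply: cvgB; [exact: slope_ratio|exact: cvg_cst].
  apply: cvgV; first by rewrite subr0 oner_neq0.
  by apply: cvgB => //; exact: cvg_cst.
rewrite subr0 divr1 addrC addKr; apply: cvg_trans; apply: near_eq_cvg.
near=> n.
have D1 : D n < 1 by near: n; apply: (cvgr_lt _ D0).
have q0 := surv_gt0 n; have q1 := surv_le1 n; have l0 : 0 < ell (Q n) by rewrite ell_gt0// q0.
have q0' := surv_gt0 n.+1; have l0' : 0 < ell (Q n.+1) by rewrite ell_gt0// surv_itv.
have qS : Q n.+1 = Q n * (1 - ell (Q n)) by rewrite survS; ring.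
have l1 : 0 < 1 - ell (Q n) by move: q0'; rewrite qS pmulr_rgt0.
(* Write l and l' for [ell] at Q(n) and Q(n+1). Then 1 - D = (1-l) l'/l and D - l = (1-l)(1 - l'/l),
   so (D/l - 1)/(1 - D) = 1/l' - 1/l. *)
have DE : D n = 1 - (1 - ell (Q n)) * ell (Q n.+1) / ell (Q n).
  rewrite /D; set l' := ell (Q n.+1); rewrite qS.
  have -> : Q n - Q n * (1 - ell (Q n)) = Q n * ell (Q n) by ring.
  by field; rewrite !gt_eqF.
rewrite /= DE; field; rewrite subKr.
by rewrite (mulf_neq0 (lt0r_neq0 l1) (lt0r_neq0 l0')) !lt0r_neq0.
Unshelve. all: by end_near. Qed.

Lemma ell_surv_asymp : n%:R * ell (Q n) @[n --> \oo] --> alpha^-1.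
Proof.
have h := cesaro inv_ell_increment.
have H : n.+1%:R^-1 * (ell (Q n.+1))^-1 @[n --> \oo] --> alpha.
  have h0 : n.+1%:R^-1 * (ell (Q 0%N))^-1 @[n --> \oo] --> (0 : R).
    by rewrite -(mul0r (ell (Q 0%N))^-1); apply: cvgMl; exact: cvg_harmonic.
  rewrite -[X in _ --> X]addr0; apply: cvg_trans (cvgD h h0); apply: near_eq_cvg.
  apply: nearW => n.
  rewrite -[LHS]/(n.+1%:R^-1 * series (telescope (fun n => (ell (Q n))^-1)) n.+1 +
    n.+1%:R^-1 * (ell (Q 0%N))^-1).
  by rewrite telescopeK -mulrDr /= subrK.
have {}H : n.+1%:R * ell (Q n.+1) @[n --> \oo] --> alpha^-1.
  apply: cvg_trans (cvgV _ H); last by rewrite gt_eqF.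
  by apply: near_eq_cvg; apply: nearW => n; rewrite /= invfM !invrK.
by rewrite -cvg_shiftS.
Qed.

Lemma ell_surv_ratio (k m : nat -> nat) (x : R) : 0 < x ->
  k n @[n --> \oo] --> \oo -> m n @[n --> \oo] --> \oo ->
  (k n)%:R / (m n)%:R @[n --> \oo] --> x ->
  ell (Q (k n)) / ell (Q (m n)) @[n --> \oo] --> x^-1.
Proof.
move=> x0 koo moo km.
have ek := cvg_comp _ _ koo ell_surv_asymp.
have em := cvg_comp _ _ moo ell_surv_asymp.
have a0 : alpha^-1 != 0 by rewrite invr_eq0 gt_eqF.
have H : ((k n)%:R * ell (Q (k n))) * ((m n)%:R * ell (Q (m n)))^-1 *
    ((k n)%:R / (m n)%:R)^-1 @[n --> \oo] --> alpha^-1 / alpha^-1 / x.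
  by apply: cvgM; [apply: (cvgM ek); exact: (cvgV a0 em)|exact: (cvgV (lt0r_neq0 x0) km)].
rewrite mulfV// mul1r in H; apply: cvg_trans H; apply: near_eq_cvg.
near=> n => /=.
have k0 : (0 < k n)%N by near: n; by move/cvgnyPgt: koo; apply.
have m0 : (0 < m n)%N by near: n; by move/cvgnyPgt: moo; apply.
have lk : 0 < ell (Q (k n)) by rewrite ell_gt0 ?surv_itv.
have lm : 0 < ell (Q (m n)) by rewrite ell_gt0 ?surv_itv.
have k0' : (0 : R) < (k n)%:R by rewrite ltr0n.
have m0' : (0 : R) < (m n)%:R by rewrite ltr0n.
by field; rewrite !lt0r_neq0.
Unshelve. all: by end_near. Qed.

(** Inverts [ell_surv_ratio] through monotonicity of [ell]. If Q(k) < c Q(m) with c^alpha < 1/x,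
    then [ell (Q k)] is at most [ell (c Q m)], which is close to c^alpha [ell (Q m)]; but it is also
    close to [ell (Q m)]/x. The value [mid] separates the two. The upper bound is symmetric. *)
Lemma surv_ratio (k m : nat -> nat) (x : R) : 0 < x ->
  k n @[n --> \oo] --> \oo -> m n @[n --> \oo] --> \oo ->
  (k n)%:R / (m n)%:R @[n --> \oo] --> x ->
  Q (k n) / Q (m n) @[n --> \oo] --> x `^ (- (1 / alpha)).
Proof.
move=> x0 koo moo km; have lkm := ell_surv_ratio x0 koo moo km.
set y := x `^ _; have y0 : 0 < y by exact: powR_gt0.
have yE : y `^ alpha = x^-1.
  by rewrite /y -powRrM mulNr div1r mulVf ?gt_eqF// powR_inv1 ?ltW.
have Qmoo := cvg_comp _ _ moo surv_cvg0.
apply: cvgr_bounds => e e0.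
  pose c := Num.max (y - e) (y / 2).
  have c0 : 0 < c by rewrite lt_max divr_gt0 ?orbT.
  have cy : c < y by rewrite gt_max; apply/andP; split; [lra|rewrite ltr_pdivrMr//; lra].
  have ca : c `^ alpha < x^-1 by rewrite -yE gt0_ltr_powR// nnegrE ltW.
  pose mid := (c `^ alpha + x^-1) / 2.
  have mid1 : c `^ alpha < mid by rewrite ltr_pdivlMr//; lra.
  have mid2 : mid < x^-1 by rewrite ltr_pdivrMr//; lra.
  near=> n; apply: (@le_trans _ _ c); first by rewrite le_max lexx.
  have qk := surv_gt0 (k n); have qm := surv_gt0 (m n).
  have lm : 0 < ell (Q (m n)) by rewrite ell_gt0 ?surv_itv.
  rewrite ler_pdivlMr// leNgt; apply/negP => h.
  have cq1 : c * Q (m n) <= 1.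
    rewrite mulrC -ler_pdivlMr//; near: n; apply: (cvgr_le _ Qmoo).
    by rewrite divr_gt0.
  have := ell_nondecreasing qk (ltW h) cq1.
  apply/negP; rewrite -ltNge.
  apply: (@lt_trans _ _ (mid * ell (Q (m n)))).
    rewrite -ltr_pdivrMr//; near: n.
    exact: (cvgr_lt _ (ell_ratio_seq c0 moo)).
  by rewrite -ltr_pdivlMr//; near: n; exact: (cvgr_gt _ lkm).
pose c := y + e.
have c0 : 0 < c by exact: addr_gt0.
have cy : y < c by rewrite ltrDl.
have ca : x^-1 < c `^ alpha by rewrite -yE gt0_ltr_powR// nnegrE ltW.
pose mid := (c `^ alpha + x^-1) / 2.
have mid1 : mid < c `^ alpha by rewrite ltr_pdivrMr//; lra.
have mid2 : x^-1 < mid by rewrite ltr_pdivlMr//; lra.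
near=> n.
have qk := surv_gt0 (k n); have qm := surv_gt0 (m n).
have lm : 0 < ell (Q (m n)) by rewrite ell_gt0 ?surv_itv.
rewrite ler_pdivrMr// leNgt; apply/negP => h.
have := ell_nondecreasing (mulr_gt0 c0 qm) (ltW h) (surv_le1 _).
apply/negP; rewrite -ltNge.
apply: (@lt_trans _ _ (mid * ell (Q (m n)))).
  by rewrite -ltr_pdivrMr//; near: n; exact: (cvgr_lt _ lkm).
rewrite -ltr_pdivlMr//; near: n.
exact: (cvgr_gt _ (ell_ratio_seq c0 moo)).
Unshelve. all: by end_near. Qed.

(** Absorbs the change of index from n to n + j with j = o(n) in [small_value_laplace], and the
    shift by one in [pred_ratio]. *)
Lemma gap_ratio (k m : nat -> nat) :
  k n @[n --> \oo] --> \oo -> m n @[n --> \oo] --> \oo ->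
  (k n)%:R / (m n)%:R @[n --> \oo] --> (1 : R) ->
  (Q (k n) * ell (Q (k n))) / (Q (m n) * ell (Q (m n))) @[n --> \oo] --> (1 : R).
Proof.
move=> koo moo km.
have H : Q (k n) / Q (m n) * (ell (Q (k n)) / ell (Q (m n))) @[n --> \oo] -->
    (1 : R) `^ (- (1 / alpha)) * 1^-1.
  by apply: cvgM; [exact: surv_ratio|exact: ell_surv_ratio].
rewrite powR1 invr1 mulr1 in H; apply: cvg_trans H; apply: near_eq_cvg.
apply: nearW => n /=.
have qm := surv_gt0 (m n).
have lm : 0 < ell (Q (m n)) by rewrite ell_gt0 ?surv_itv.
by field; rewrite !lt0r_neq0.
Qed.

Lemma iter_f_itv n s : 0 <= s <= 1 -> 0 <= iter n f s <= 1.
Proof. by move=> s01; elim: n => //= n; apply: f_itv. Qed.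

Lemma iter_f_le n s r : 0 <= s -> s <= r -> r <= 1 -> iter n f s <= iter n f r.
Proof.
move=> s0 sr r1; elim: n => //= n IHn.
have s01 : 0 <= s <= 1 by rewrite s0 (le_trans sr).
have r01 : 0 <= r <= 1 by rewrite (le_trans s0 sr).
apply: f_le => //; first by case/andP: (iter_f_itv n s01).
by case/andP: (iter_f_itv n r01).
Qed.

Lemma iter_f0 n : iter n f 0 = 1 - Q n.
Proof. by rewrite /surv subKr. Qed.

Lemma iter_surv n j : iter n f (1 - Q j) = 1 - Q (n + j).
Proof. by rewrite /surv !subKr iterD. Qed.

Lemma onem_expR_le (t : R) : 1 - expR (- t) <= t.
Proof. by have := expR_ge1Dx (- t); lra. Qed.

Lemma onem_expR_ge (t : R) : 0 <= t -> t / (1 + t) <= 1 - expR (- t).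
Proof.
move=> t0; have t1 : 0 < 1 + t by lra.
have h : expR (- t) <= (1 + t)^-1.
  by rewrite expRN lef_pV2 ?posrE ?expR_gt0// expR_ge1Dx.
have -> : t / (1 + t) = 1 - (1 + t)^-1 by field; rewrite gt_eqF.
by rewrite lerB.
Qed.

(** * Comparison of exp(-lam Q(m)) with iterates of f at 0 *)

Section laplace_bracket.
Variables (m : nat -> nat) (lam : R).
Hypotheses (moo : m n @[n --> \oo] --> \oo) (lam0 : 0 < lam).

Let s n := expR (- (lam * Q (m n))).
Let j (c : R) n := Num.truncn (c * (m n)%:R).

Let mRoo : ((m n)%:R : R) @[n --> \oo] --> +oo.
Proof. exact/cvgrnyP. Qed.

Lemma truncn_ratio c : 0 < c -> (j c n)%:R / (m n)%:R @[n --> \oo] --> c.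
Proof. by move=> c0; exact: (truncn_cvg_ratio c0 mRoo). Qed.

Lemma truncn_oo c : 0 < c -> j c n @[n --> \oo] --> \oo.
Proof. by move=> c0; exact: (truncn_cvgy c0 mRoo). Qed.

Let invE (c : R) : 0 < c -> (c `^ (- (1 / alpha))) `^ (- alpha) = c.
Proof.
by move=> c0; rewrite -powRrM mulrNN div1r mulVf ?lt0r_neq0// powRr1// ltW.
Qed.

(** Q(j)/Q(m) tends to c^(-1/alpha) > lam, so eventually Q(j) >= lam Q(m) >= 1 - exp(-lam Q(m)). *)
Lemma laplace_ge c : 0 < c < lam `^ (- alpha) ->
  \forall n \near \oo, 1 - Q (j c n) <= s n.
Proof.
move=> /andP[c0 cl].
have yl : lam < c `^ (- (1 / alpha)).
  rewrite ltNge; apply/negP => h; move: cl; apply/negP; rewrite -leNgt.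
  rewrite -[leRHS](invE c0) (powRN lam) (powRN (c `^ _)) lef_pV2 ?posrE ?powR_gt0//.
  by apply: ge0_ler_powR => //; rewrite ?nnegrE ?powR_ge0//; exact: ltW.
have H := surv_ratio c0 (truncn_oo c0) moo (truncn_ratio c0).
near=> n.
have qm := surv_gt0 (m n).
have : lam <= Q (j c n) / Q (m n) by near: n; exact: (cvgr_ge _ H).
rewrite ler_pdivlMr// => h; have := onem_expR_le (lam * Q (m n)).
by rewrite /s; lra.
Unshelve. all: by end_near. Qed.

Lemma laplace_le c : lam `^ (- alpha) < c ->
  \forall n \near \oo, s n <= 1 - Q (j c n).
Proof.
move=> cl; have c0 : 0 < c by apply: le_lt_trans cl; exact: powR_ge0.
set y := c `^ (- (1 / alpha)).
have yl : y < lam.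
  rewrite ltNge; apply/negP => h; move: cl; apply/negP; rewrite -leNgt.
  rewrite -[leLHS](invE c0) (powRN lam) (powRN (c `^ _)) lef_pV2 ?posrE ?powR_gt0//.
  by apply: ge0_ler_powR => //; rewrite ?nnegrE ?powR_ge0//; exact: ltW.
have y0 : 0 < y by exact: powR_gt0.
have H := surv_ratio c0 (truncn_oo c0) moo (truncn_ratio c0).
pose mid := (y + lam) / 2.
have mid1 : y < mid by rewrite ltr_pdivlMr//; lra.
have mid2 : mid < lam by rewrite ltr_pdivrMr//; lra.
have mid0 : 0 < mid by exact: lt_trans mid1.
near=> n.
have qm := surv_gt0 (m n).
have : Q (j c n) / Q (m n) <= mid by near: n; exact: (cvgr_le _ H).
rewrite ler_pdivrMr// => h.
(* The bound 1 - exp(-t) >= t/(1+t) loses a second-order term; since mid < lam it is absorbed once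
   mid (1 + lam Q(m)) <= lam. *)
have lq : mid * (lam * Q (m n)) <= lam - mid.
  rewrite mulrA mulrC -ler_pdivlMr; last exact: mulr_gt0 mid0 lam0.
  near: n.
  apply: (cvgr_le _ (cvg_comp _ _ moo surv_cvg0)).
  by apply: divr_gt0; [rewrite subr_gt0|exact: mulr_gt0 mid0 lam0].
have lq0 : 0 < lam * Q (m n) by exact: mulr_gt0.
have := onem_expR_ge (ltW lq0); rewrite -/(s n).
have : mid * Q (m n) <= lam * Q (m n) / (1 + lam * Q (m n)).
  rewrite ler_pdivlMr ?addr_gt0// mulrAC ler_wpM2r// ?(ltW qm)//.
  by rewrite mulrDr mulr1; lra.
by lra.
Unshelve. all: by end_near. Qed.

End laplace_bracket.

Local Notation gap n := (Q n * ell (Q n)).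

Lemma gap_gt0 n : 0 < gap n.
Proof. by rewrite mulr_gt0 ?surv_gt0// ell_gt0// surv_itv. Qed.

Lemma gap_nonincreasing k n : (k <= n)%N -> gap n <= gap k.
Proof.
move=> kn; have qq := surv_nonincreasing kn.
rewrite ler_pM ?(ltW (surv_gt0 _))//; first by rewrite ltW// ell_gt0// surv_itv.
by apply: ell_nondecreasing; rewrite ?surv_gt0 ?surv_le1.
Qed.

(** The difference is a sum of j consecutive gaps, and the gaps decrease. *)
Lemma surv_diff n j : j%:R * gap (n + j)%N <= Q n - Q (n + j)%N <= j%:R * gap n.
Proof.
elim: j => [|j /andP[lo hi]]; first by rewrite addn0 subrr !mul0r lexx.
have h1 : gap (n + j.+1)%N <= gap (n + j)%N.
  by apply: gap_nonincreasing; rewrite addnS.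
have h2 := gap_nonincreasing (leq_addr j n).
have h3 : j%:R * gap (n + j.+1)%N <= j%:R * gap (n + j)%N by rewrite ler_wpM2l.
have eS : Q n - Q (n + j.+1)%N = (Q n - Q (n + j)%N) + gap (n + j)%N.
  by rewrite addnS survS; ring.
have mE (g : R) : j.+1%:R * g = j%:R * g + g by rewrite -natr1 mulrDl mul1r.
rewrite eS !mE; apply/andP; split; last exact: lerD.
by apply: lerD => //; exact: le_trans lo.
Qed.

Lemma addn_truncn_ratio (m : nat -> nat) (c : R) : 0 < c ->
  m n @[n --> \oo] --> \oo -> ((m n)%:R : R) / n%:R @[n --> \oo] --> (0 : R) ->
  ((n + Num.truncn (c * (m n)%:R))%N%:R : R) / n%:R @[n --> \oo] --> (1 : R).
Proof.
move=> c0 moo mn0.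
have H : 1 + (Num.truncn (c * (m n)%:R))%:R / (m n)%:R * ((m n)%:R / n%:R)
    @[n --> \oo] --> (1 + c * 0 : R).
  by apply: cvgD; [exact: cvg_cst|apply: cvgM => //; exact: truncn_ratio].
rewrite mulr0 addr0 in H; apply: cvg_trans H; apply: near_eq_cvg; near=> n.
have n0 : (0 < n)%N by near: n; exists 1%N.
have m0 : (0 < m n)%N by near: n; move/cvgnyPgt: moo; apply.
by rewrite /= natrD; field; rewrite !pnatr_eq0 -!lt0n n0 m0.
Unshelve. all: by end_near. Qed.

Lemma addn_oo (j : nat -> nat) : (n + j n)%N @[n --> \oo] --> \oo.
Proof.
apply/cvgnyPge => N; near=> n; rewrite (@leq_trans n) ?leq_addr//.
by near: n; exists N.
Unshelve. all: by end_near. Qed.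

(** The numerator is the Laplace transform of Q(m) Z(n) on Z(n) > 0. Replacing the exponential by
    f_j(0) with j close to c m turns it into Q(n) - Q(n+j), about c m gap(n) because j = o(n); then
    c tends to lam^(-alpha). *)
Lemma small_value_laplace (m : nat -> nat) (lam : R) : 0 < lam ->
  m n @[n --> \oo] --> \oo -> ((m n)%:R : R) / n%:R @[n --> \oo] --> (0 : R) ->
  (iter n f (expR (- (lam * Q (m n)))) - iter n f 0) / ((m n)%:R * gap n)
    @[n --> \oo] --> lam `^ (- alpha).
Proof.
move=> lam0 moo mn0; apply: (@cvgr_interval _ _ _ id) => //; first exact: powR_gt0.
- move=> c e /andP[c0 cl] e0; pose j n := Num.truncn (c * (m n)%:R).
  have H : (j n)%:R / (m n)%:R * (gap (n + j n)%N / gap n) @[n --> \oo] --> c * 1.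
    apply: cvgM; first exact: truncn_ratio.
    by apply: gap_ratio => //; [exact: addn_oo|exact: addn_truncn_ratio].
  near=> n.
  have m0 : (0 : R) < (m n)%:R by rewrite ltr0n; near: n; move/cvgnyPgt: moo; apply.
  apply: (@le_trans _ _ ((j n)%:R / (m n)%:R * (gap (n + j n)%N / gap n))).
    by near: n; apply: (cvgr_ge _ H); rewrite mulr1 gtrBl.
  have g0 := gap_gt0 n.
  have -> : (j n)%:R / (m n)%:R * (gap (n + j n)%N / gap n) =
     (j n)%:R * gap (n + j n)%N / ((m n)%:R * gap n).
    by field; rewrite !lt0r_neq0 ?surv_gt0// ell_gt0// surv_itv.
  apply: ler_wpM2r; first by rewrite invr_ge0 ltW// (mulr_gt0 m0 g0).
  have /andP[h _] := surv_diff n (j n); apply: (le_trans h).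
  have sj : 1 - Q (j n) <= expR (- (lam * Q (m n))).
    by near: n; apply: laplace_ge => //; rewrite c0.
  have := iter_f_le n _ sj; rewrite iter_surv subr_ge0 surv_le1 => /(_ isT).
  rewrite -expR0 ler_expR oppr_le0 mulr_ge0 ?(ltW lam0) ?(ltW (surv_gt0 _))// => /(_ isT).
  by rewrite expR0 iter_f0; lra.
- move=> c e cl e0; have c0 : 0 < c by apply: le_lt_trans cl; exact: powR_ge0.
  pose j n := Num.truncn (c * (m n)%:R).
  have H : (j n)%:R / (m n)%:R @[n --> \oo] --> c by exact: truncn_ratio.
  near=> n.
  have m0 : (0 : R) < (m n)%:R by rewrite ltr0n; near: n; move/cvgnyPgt: moo; apply.
  apply: (@le_trans _ _ ((j n)%:R / (m n)%:R)); last first.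
    by near: n; apply: (cvgr_le _ H); rewrite ltrDl.
  have g0 := gap_gt0 n.
  have -> : (j n)%:R / (m n)%:R = (j n)%:R * gap n / ((m n)%:R * gap n).
    by field; rewrite !lt0r_neq0 ?surv_gt0// ell_gt0// surv_itv.
  apply: ler_wpM2r; first by rewrite invr_ge0 ltW// (mulr_gt0 m0 g0).
  have /andP[_ h] := surv_diff n (j n); apply: le_trans h.
  have sj : expR (- (lam * Q (m n))) <= 1 - Q (j n).
    by near: n; apply: laplace_le.
  have := iter_f_le n (expR_ge0 _) sj; rewrite iter_surv gerBl (ltW (surv_gt0 _)) => /(_ isT).
  by rewrite iter_f0; lra.
Unshelve. all: by end_near. Qed.

(** Same comparison at the scale j close to c n, where Q(n+j)/Q(n) tends to (1+c)^(-1/alpha). *)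
Lemma conditional_laplace (lam : R) : 0 < lam ->
  (iter n f (expR (- (lam * Q n))) - iter n f 0) / Q n
    @[n --> \oo] --> 1 - 1 / (1 + lam `^ (- alpha)) `^ (1 / alpha).
Proof.
move=> lam0; have ioo : (fun n : nat => n) @ \oo --> \oo by [].
pose H c : R := 1 - (1 + c) `^ (- (1 / alpha)).
have -> : 1 - 1 / (1 + lam `^ (- alpha)) `^ (1 / alpha) = H (lam `^ (- alpha)).
  by rewrite /H (powRN (1 + _)) [in LHS]div1r.
have ratio (c : R) : 0 < c -> ((n + Num.truncn (c * n%:R))%N%:R : R) / n%:R @[n --> \oo] --> 1 + c.
  move=> c0.
  have K : 1 + (Num.truncn (c * n%:R))%:R / n%:R @[n --> \oo] --> (1 + c : R).
    by apply: cvgD; [exact: cvg_cst|exact: (truncn_ratio ioo)].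
  apply: cvg_trans K; apply: near_eq_cvg; near=> n.
  have n0 : (0 < n)%N by near: n; exists 1%N.
  by rewrite /= natrD; field; rewrite !pnatr_eq0 -!lt0n n0.
have K c : 0 < c -> 1 - Q (n + Num.truncn (c * n%:R))%N / Q n @[n --> \oo] --> H c.
  move=> c0; apply: cvgB; first exact: cvg_cst.
  by apply: surv_ratio => //; [rewrite addr_gt0|exact: addn_oo|exact: ratio].
apply: cvgr_interval; first exact: powR_gt0.
- apply: cvgB; first exact: cvg_cst.
  have y1 : 0 < 1 + lam `^ (- alpha) by rewrite addr_gt0// powR_gt0.
  apply: (cvg_comp (fun c : R => 1 + c) (fun z => z `^ (- (1 / alpha))) (G := nbhs (1 + lam `^ (- alpha)))).
    by apply: cvgD; [exact: cvg_cst|exact: cvg_id].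
  have : {for 1 + lam `^ (- alpha), continuous (fun z => z `^ (- (1 / alpha)))}.
    apply: differentiable_continuous; apply/derivable1_diffP.
    by have [] := is_derive1_powR (- (1 / alpha)) y1.
  by [].
- move=> c e /andP[c0 cl] e0; near=> n.
  have q0 := surv_gt0 n.
  apply: (@le_trans _ _ (1 - Q (n + Num.truncn (c * n%:R))%N / Q n)).
    by near: n; apply: (cvgr_ge _ (K c c0)); rewrite gtrBl.
  rewrite ler_pdivlMr// mulrBl mul1r divfK ?lt0r_neq0//.
  have sj : 1 - Q (Num.truncn (c * n%:R)) <= expR (- (lam * Q n)).
    by near: n; apply: (laplace_ge ioo) => //; rewrite c0.
  have := iter_f_le n _ sj; rewrite iter_surv subr_ge0 surv_le1 => /(_ isT).
  rewrite -expR0 ler_expR oppr_le0 mulr_ge0 ?(ltW lam0) ?(ltW (surv_gt0 _))// => /(_ isT).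
  by rewrite expR0 iter_f0; lra.
- move=> c e cl e0; have c0 : 0 < c by apply: le_lt_trans cl; exact: powR_ge0.
  near=> n; have q0 := surv_gt0 n.
  apply: (@le_trans _ _ (1 - Q (n + Num.truncn (c * n%:R))%N / Q n)); last first.
    by near: n; apply: (cvgr_le _ (K c c0)); rewrite ltrDl.
  rewrite ler_pdivrMr// mulrBl mul1r divfK ?lt0r_neq0//.
  have sj : expR (- (lam * Q n)) <= 1 - Q (Num.truncn (c * n%:R)).
    by near: n; apply: (laplace_le ioo).
  have := iter_f_le n (expR_ge0 _) sj; rewrite iter_surv gerBl (ltW (surv_gt0 _)) => /(_ isT).
  by rewrite iter_f0; lra.
Unshelve. all: by end_near. Qed.

End critical_iteration.

(** * Convergence of Laplace transforms *)

(** The integral of v q(v) with v = expR(- lam y). The factor v raises the i-th power to i + 1, so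
    [Psi] is evaluated at positive arguments, where it is finite even for an infinite measure. *)
Definition laplace_comb (R : realType) (Psi : R -> R) (q : {poly R}) (lam : R) : R :=
  \sum_(i < size q) q`_i * Psi (lam * i.+1%:R).

(* Some measure on [0, +oo[ has distribution function [U] and Laplace transform
   [Psi]; only the inequalities obtained by integrating polynomials in
   [expR (- lam * y)] without constant term are recorded, which makes the notion
   independent of the space carrying the measure. *)
Definition laplace_pair (R : realType) (U Psi : R -> R) : Prop :=
  forall (lam delta : R) (q : {poly R}), 0 < lam ->
  (forall y0 : R, (forall y : R, 0 <= y -> (y <= y0)%R%:R - delta * expR (- (lam * y)) <=
       expR (- (lam * y)) * q.[expR (- (lam * y))]) ->
     U y0 <= laplace_comb Psi q lam + delta * Psi lam) /\
  (forall y1 : R, (forall y : R, 0 <= y -> expR (- (lam * y)) * q.[expR (- (lam * y))] <=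
       (y <= y1)%R%:R + delta * expR (- (lam * y))) ->
     laplace_comb Psi q lam <= U y1 + delta * Psi lam).

Lemma laplace_combZ (R : realType) (Psi : R -> R) (q : {poly R}) (lam b : R) :
  laplace_comb (fun l => Psi l / b) q lam = laplace_comb Psi q lam / b.
Proof. by rewrite /laplace_comb mulr_suml; apply: eq_bigr => i _; rewrite mulrA. Qed.

Lemma laplace_pairZ (R : realType) (U Psi : R -> R) (b : R) : 0 < b ->
  laplace_pair U Psi -> laplace_pair (fun y => U y / b) (fun l => Psi l / b).
Proof.
move=> b0 UP lam delta q lam0; have [h1 h2] := UP lam delta q lam0.
have b0' : 0 <= b^-1 by rewrite invr_ge0 ltW.
by split=> y H; rewrite laplace_combZ mulrA -mulrDl ler_wpM2r//; [exact: h1|exact: h2].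
Qed.

Section laplace_pair_of_measure.
Context (R : realType) (d : measure_display) (T : measurableType d)
  (mu : {measure set T -> \bar R}) (D : set T) (Y : T -> R) (Psi : R -> R).
Hypothesis mD : measurable D.
Hypothesis mY : measurable_fun D Y.
Hypothesis Y0 : forall w, D w -> 0 <= Y w.
Hypothesis PsiE : forall lam : R, 0 < lam ->
  (\int[mu]_(w in D) (expR (- (lam * Y w)))%:E = (Psi lam)%:E)%E.

Let E lam w := expR (- (lam * Y w)).

Let mE lam : measurable_fun D (fun w => (E lam w)%:E).
Proof.
apply/measurable_EFinP; apply: (measurableT_comp (f := @expR R)) => //.
apply: (measurableT_comp (f := -%R : R -> R)) => //.
exact: measurable_funM.
Qed.

Let iE (lam : R) : 0 < lam -> mu.-integrable D (fun w => (E lam w)%:E).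
Proof.
move=> lam0; apply/integrableP; split; first exact: mE.
under eq_integral => w _ do rewrite abse_EFin ger0_norm ?expR_ge0//.
by rewrite PsiE// ltry.
Qed.

Let F (q : {poly R}) lam w : R := E lam w * q.[E lam w].

Let FE q lam w : (F q lam w)%:E =
  (\sum_(i < size q) (q`_i)%:E * (E (lam * i.+1%:R) w)%:E)%E.
Proof.
under [RHS]eq_bigr do rewrite -EFinM.
rewrite sumEFin /F horner_coef mulr_sumr; congr EFin; apply: eq_bigr => i _.
rewrite mulrCA -exprS /E -expRM_natl; congr (_ * expR _).
by rewrite mulrN mulrCA !mulrA.
Qed.

Let iF q (lam : R) : 0 < lam -> mu.-integrable D (fun w => (F q lam w)%:E).
Proof.
move=> lam0; under eq_fun do rewrite FE.
by apply: integrable_sum => // i _; apply: integrableZl => //; apply: iE; rewrite mulr_gt0.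
Qed.

Let intF q (lam : R) : 0 < lam ->
  (\int[mu]_(w in D) (F q lam w)%:E = (laplace_comb Psi q lam)%:E)%E.
Proof.
move=> lam0; under eq_integral do rewrite FE.
rewrite integral_sum//; last first.
  by move=> i; apply: integrableZl => //; apply: iE; rewrite mulr_gt0.
rewrite /laplace_comb -sumEFin; apply: eq_bigr => i _; rewrite EFinM.
have li : 0 < lam * i.+1%:R by rewrite mulr_gt0.
by rewrite integralZl//; [rewrite PsiE|exact: iE].
Qed.

Let mlevel y : measurable (D `&` [set w | Y w <= y]).
Proof.
have -> : [set w | Y w <= y] = Y @^-1` `]-oo, y].
  by apply/seteqP; split => w; rewrite /= in_itv.
exact: mY.
Qed.

Let intI y : (\int[mu]_(w in D) ((Y w <= y)%R%:R : R)%:E = mu (D `&` [set w | (Y w <= y)%R]))%E.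
Proof.
transitivity (\int[mu]_(w in D) (\1_(D `&` [set v | (Y v <= y)%R]) w : R)%:E)%E.
  apply: eq_integral => w wD; rewrite indicE in_setI wD/=.
  have -> : (w \in [set v | Y v <= y]) = (Y w <= y)%R by apply/idP/idP => [/set_mem|/mem_set].
  by [].
by rewrite integral_indic// setIAC setIid.
Qed.

Let mI y : measurable_fun D (fun w => ((Y w <= y)%R%:R : R)%:E).
Proof.
apply/measurable_EFinP.
rewrite (_ : (fun w => _) = (\1_`]-oo, y] \o Y : T -> R)).
  exact: measurableT_comp.
by apply/funext => w /=; rewrite indicE mem_setE in_itv.
Qed.

(** [mu] may be infinite, but expR(y) expR(- Y) is at least 1 where Y <= y, which bounds the mass by
    [expR y * Psi 1]. *)
Let finI y : (mu (D `&` [set w | (Y w <= y)%R]) < +oo)%E.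
Proof.
rewrite -intI; apply: (@le_lt_trans _ _ (\int[mu]_(w in D) ((expR y)%:E * (E 1 w)%:E))%E).
  apply: ge0_le_integral => //.
  - exact: measurable_funeM.
  - move=> w Dw; rewrite -EFinM lee_fin /E -expRD mul1r.
    by have [Yy|] := leP (Y w) y; rewrite ?expR_ge0//= -expR0 ler_expR subr_ge0.
by rewrite integralZl//; [rewrite PsiE// -EFinM ltry|exact: iE].
Qed.

Let iI y : mu.-integrable D (fun w => ((Y w <= y)%R%:R : R)%:E).
Proof.
apply/integrableP; split.
  exact: mI.
under eq_integral => w _ do rewrite abse_EFin ger0_norm//.
by rewrite intI.
Qed.

Lemma laplace_pair_measure :
  laplace_pair (fun y => fine (mu (D `&` [set w | Y w <= y]))) Psi.
Proof.
move=> lam delta q lam0.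
have fE y : ((fine (mu (D `&` [set w | (Y w <= y)%R])))%:E =
    \int[mu]_(w in D) ((Y w <= y)%R%:R : R)%:E)%E.
  by rewrite fineK ?intI// ge0_fin_numE.
have iZ : mu.-integrable D (fun w => delta%:E * (E lam w)%:E)%E.
  by apply: integrableZl => //; exact: iE.
have intZ : (\int[mu]_(w in D) (delta%:E * (E lam w)%:E) = (delta * Psi lam)%:E)%E.
  by rewrite integralZl//; [rewrite PsiE|exact: iE].
split=> y H; rewrite -lee_fin [leRHS]EFinD -intZ fE -intF//.
  rewrite -integralD//; last exact: iF.
  apply: le_integral => //; first by apply: integrableD => //; exact: iF.
  move=> w /set_mem wD; rewrite -EFinM -EFinD lee_fin -lerBlDr.
  exact: H _ (Y0 wD).
rewrite -integralD//.
apply: le_integral => //; [exact: iF|exact: integrableD|].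
move=> w /set_mem wD; rewrite -EFinM -EFinD lee_fin.
exact: H _ (Y0 wD).
Qed.

End laplace_pair_of_measure.

Lemma cutoff_upper (R : realDomainType) (v : R) (n N : nat) : 0 <= v <= 1 ->
  1 - (1 - v ^+ n) ^+ N <= N%:R * v ^+ n.
Proof.
move=> /andP[v0 v1]; have x1 : 0 <= 1 - v ^+ n by rewrite subr_ge0 exprn_ile1.
by have := exprn_support_line N (@ler01 R) x1; rewrite !expr1n; lra.
Qed.

(** With x = v^n, (1-x)(1+x) <= 1 bounds (1-x)^N by the inverse of (1+x)^N, and Bernoulli gives
    (1+x)^N >= N x. *)
Lemma cutoff_lower (R : realFieldType) (v : R) (n N : nat) : 0 < v <= 1 -> (0 < N)%N ->
  (1 - v ^+ n) ^+ N <= (N%:R * v ^+ n)^-1.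
Proof.
move=> /andP[v0 v1] N0; set x := v ^+ n.
have x0 : 0 < x by exact: exprn_gt0.
have x1 : x <= 1 by rewrite exprn_ile1 ?(ltW v0).
have Nx : 0 < N%:R * x by rewrite mulr_gt0 ?ltr0n.
have p0 : 0 <= (1 - x) ^+ N by rewrite exprn_ge0// subr_ge0.
have h : N%:R * x <= (1 + x) ^+ N.
  have x2 : 0 <= 1 + x by lra.
  by have := exprn_support_line N (@ler01 R) x2; rewrite !expr1n; lra.
rewrite -[leRHS]mul1r ler_pdivlMr//; apply: le_trans (ler_wpM2l p0 h) _.
rewrite -exprMn_comm; last exact: mulrC.
have -> : (1 - x) * (1 + x) = 1 - x ^+ 2 by ring.
have x2 : x ^+ 2 <= 1 by rewrite exprn_ile1// ltW.
by have := sqr_ge0 x => ?; apply: exprn_ile1; lra.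
Qed.

(* Take [1 - (1 - v ^+ n) ^+ (2 ^ n)] in [v = expR (- lam * y)]: for large [n] it is
   close to the indicator of [v > 1/2], and [lam] puts the threshold between [y0]
   and [y1]. *)
Lemma polynomial_cutoff (R : realType) (y0 y1 : R) : 0 < y0 < y1 ->
  exists2 lam : R, 0 < lam & forall delta, 0 < delta ->
  exists q : {poly R}, forall y : R, 0 <= y ->
    (y <= y0)%R%:R - delta * expR (- (lam * y)) <=
      expR (- (lam * y)) * q.[expR (- (lam * y))] <=
    (y <= y1)%R%:R + delta * expR (- (lam * y)).
Proof.
move=> /andP[y00 y01]; pose ym := (y0 + y1) / 2.
have y0m : y0 < ym by rewrite ltr_pdivlMr//; lra.
have ym1 : ym < y1 by rewrite ltr_pdivrMr//; lra.
have ym0 : 0 < ym by exact: lt_trans y0m.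
have ln2 : 0 < ln (2 : R) by rewrite ln_gt0// ltr1n.
pose lam := ln 2 / ym; have lam0 : 0 < lam by rewrite divr_gt0.
exists lam => // delta delta0.
pose V (y : R) := expR (- (lam * y)).
have Vm : V ym = 2^-1 by rewrite /V /lam divfK ?gt_eqF// expRN lnK// posrE.
have V0 y : 0 < V y by exact: expR_gt0.
have Vle a b : a <= b -> V b <= V a.
  by move=> ab; rewrite ler_expR lerN2 ler_wpM2l ?(ltW lam0).
have Vlt a b : a < b -> V b < V a.
  by move=> ab; rewrite ltr_expR ltrN2 ltr_pM2l.
have v1 : 0 < 2 * V y1 < 1.
  by rewrite mulr_gt0//= mulrC -ltr_pdivlMr// div1r -Vm Vlt.
have v0 : 0 < (2 * V y0)^-1 < 1.
  have : 1 < 2 * V y0 by rewrite mulrC -ltr_pdivrMr// div1r -Vm Vlt.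
  by move=> h; rewrite invr_gt0 invf_lt1 ?h ?andbT; lra.
have [k [k1 k2]] : exists k, 2 * (2 * V y1) ^+ k <= delta /\
    (2 * V y0)^-1 ^+ k <= delta * V y0.
  have c1 : (2 * V y1) ^+ k @[k --> \oo] --> (0 : R).
    by apply: cvg_expr; case/andP: v1 => a b; rewrite gtr0_norm.
  have c2 : (2 * V y0)^-1 ^+ k @[k --> \oo] --> (0 : R).
    by apply: cvg_expr; case/andP: v0 => a b; rewrite gtr0_norm.
  near \oo => k; exists k; split; last first.
    by near: k; apply: (cvgr_le _ c2); rewrite mulr_gt0.
  rewrite mulrC -ler_pdivlMr//; near: k; apply: (cvgr_le _ c1).
  by rewrite divr_gt0.
(* N v^n = (2v)^n is small for v < 1/2 and large for v > 1/2. The exponent k + 1 leaves a spare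
   factor V y, making the error beyond y1 a multiple of expR(- lam y). *)
pose n := k.+1; pose N := (2 ^ n)%N.
have N0 : (0 < N)%N by rewrite expn_gt0.
have NE : N%:R = 2 ^+ n :> R by rewrite natrX.
pose g : {poly R} := 1 - (1 - 'X^n) ^+ N.
have gE v : g.[v] = 1 - (1 - v ^+ n) ^+ N.
  by rewrite /g hornerD hornerN horner_exp hornerD hornerN hornerXn !hornerE.
(* g vanishes at 0, so it has no constant term and factors as X times q. *)
have /factor_theorem[q qE] : root g 0.
  by rewrite rootE gE expr0n /= subr0 expr1n subrr.
exists q => y yge0; rewrite -/(V y).
have -> : V y * q.[V y] = g.[V y].
  by rewrite qE hornerM hornerXsubC subr0 mulrC.
have Vy1 : V y <= 1.
  by rewrite -expR0 ler_expR oppr_le0 mulr_ge0// ltW.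
have x01 : 0 <= 1 - V y ^+ n <= 1.
  by rewrite subr_ge0 exprn_ile1 ?(ltW (V0 y))//= gerBl exprn_ge0// ltW.
have g01 : 0 <= g.[V y] <= 1.
  case/andP: x01 => x0 x1.
  by rewrite gE subr_ge0 exprn_ile1//= gerBl exprn_ge0.
have dV : 0 < delta * V y by rewrite mulr_gt0.
apply/andP; split.
  have [yy|_] := leP y y0; last first.
    by rewrite sub0r (@le_trans _ _ 0) ?oppr_le0 ?(ltW dV)//; case/andP: g01.
  rewrite gE lerD2l lerN2.
  have Vy : 0 < V y <= 1 by rewrite V0.
  apply: (le_trans (cutoff_lower _ Vy N0)).
  rewrite NE -exprMn_comm; last exact: mulrC.
  apply: (@le_trans _ _ ((2 * V y0)^-1 ^+ n)).
    rewrite -exprVn lerXn2r ?nnegrE ?invr_ge0 ?mulr_ge0 ?(ltW (V0 _))//.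
    by rewrite lef_pV2 ?posrE ?mulr_gt0// ler_pM2l// Vle.
  apply: (@le_trans _ _ ((2 * V y0)^-1 ^+ k)).
    by case/andP: v0 => a b; rewrite exprSr ler_piMr ?exprn_ge0 ?ltW.
  by apply: (le_trans k2); rewrite ler_pM2l// Vle.
have [yy|yy] := leP y y1; first by case/andP: g01 => _ g1; rewrite (le_trans g1)// lerDl ltW.
rewrite add0r gE; have Vy : 0 <= V y <= 1 by rewrite (ltW (V0 y)).
apply: (le_trans (cutoff_upper _ _ Vy)).
rewrite NE -exprMn_comm; last exact: mulrC.
rewrite exprS mulrAC ler_pM2r// (le_trans _ k1)// ler_pM2l//.
by rewrite lerXn2r ?nnegrE ?mulr_ge0 ?(ltW (V0 _))// ler_pM2l// Vle// ltW.
Unshelve. all: by end_near. Qed.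

(** U may jump, hence the two levels y0 < y1. One polynomial fits between the two indicators up to
    delta expR(- lam y), and its integral is a finite combination of values of the transforms, so
    pointwise convergence is enough. *)
Lemma laplace_continuity (R : realType) (U_ Psi_ : nat -> R -> R) (U Psi : R -> R) :
  (\forall n \near \oo, laplace_pair (U_ n) (Psi_ n)) -> laplace_pair U Psi ->
  (forall lam, 0 < lam -> Psi_ n lam @[n --> \oo] --> Psi lam) ->
  forall y0 y1 e : R, 0 < y0 < y1 -> 0 < e ->
    \forall n \near \oo, U_ n y0 <= U y1 + e /\ U y0 - e <= U_ n y1.
Proof.
move=> U_P UP PsiP y0 y1 e y01 e0.
have [lam lam0 cut] := polynomial_cutoff y01.
(* Four errors of at most e/4 add up: delta Psi occurs twice, and passing to the limit costs e/4 in
   the combination and e/4 in the delta term. *)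
pose delta := e / (4 * (`|Psi lam| + 1)).
have p0 : 0 < 4 * (`|Psi lam| + 1) by rewrite mulr_gt0// ltr_wpDl.
have delta0 : 0 < delta by rewrite divr_gt0.
have dP : delta * Psi lam <= e / 4.
  apply: (@le_trans _ _ (delta * (`|Psi lam| + 1))).
    by rewrite ler_pM2l// (le_trans (ler_norm _))// lerDl.
  by rewrite /delta invfM mulrA mulfVK// gt_eqF// ltr_wpDl.
have [q Hq] := cut _ delta0.
have Hlo y : 0 <= y -> _ := fun h => (elimTF andP (Hq y h)).1.
have Hhi y : 0 <= y -> _ := fun h => (elimTF andP (Hq y h)).2.
have cc : laplace_comb (Psi_ n) q lam @[n --> \oo] --> laplace_comb Psi q lam.
  rewrite /laplace_comb; apply: cvg_big => [|i _]; first exact: add_continuous.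
  by apply: cvgMr; apply: PsiP; rewrite mulr_gt0.
have cd : delta * Psi_ n lam @[n --> \oo] --> delta * Psi lam.
  by apply: cvgMr; exact: PsiP.
have e4 : 0 < e / 4 by rewrite divr_gt0.
have [U1 U2] := UP lam delta q lam0.
have {}U1 := U1 y0 Hlo; have {}U2 := U2 y1 Hhi.
near=> n.
have Un : laplace_pair (U_ n) (Psi_ n) by near: n; exact: U_P.
have [Un1 Un2] := Un lam delta q lam0.
have {}Un1 := Un1 y0 Hlo; have {}Un2 := Un2 y1 Hhi.
have c1 : laplace_comb (Psi_ n) q lam <= laplace_comb Psi q lam + e / 4.
  by near: n; apply: (cvgr_le _ cc); rewrite ltrDl.
have c2 : laplace_comb Psi q lam - e / 4 <= laplace_comb (Psi_ n) q lam.
  by near: n; apply: (cvgr_ge _ cc); rewrite gtrBl.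
have c3 : delta * Psi_ n lam <= delta * Psi lam + e / 4.
  by near: n; apply: (cvgr_le _ cd); rewrite ltrDl.
by split; lra.
Unshelve. all: by end_near. Qed.

(** The measure is prescribed on intervals open on the left, while an atom at 0 must be counted:
    [0, y] is ]-1, y] without ]-1, 0[, and the latter is exhausted by intervals on which M is 0. *)
Lemma stieltjes_level (R : realType) (M : cumulativeBounded (0 : R) (1 : R)) (y : R) :
  (forall z, z < 0 -> M z = 0) -> 0 <= y ->
  lebesgue_stieltjes_measure M (`[0, +oo[%classic `&` [set z | z <= y]) = (M y)%:E.
Proof.
move=> M0 y0; set mu := lebesgue_stieltjes_measure M.
have muE (a b : R) : a <= b -> mu `]a, b]%classic = (M b - M a)%:E.
  move=> ab; rewrite /mu /lebesgue_stieltjes_measure /measure_extension measurable_mu_extE/=; last exact: is_ocitv.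
  by rewrite wlength_itv_bnd.
have -> : `[0, +oo[ `&` [set z | z <= y] = `[0, y]%classic.
  apply/seteqP; split => z /=; rewrite !in_itv/= ?andbT.
    by case=> -> ->.
  by case/andP.
have neg0 : mu `](-1 : R), 0[%classic = 0%E.
  have -> : `](-1 : R), 0[%classic = \bigcup_k `]-1, - k.+1%:R^-1 : R]%classic.
    by rewrite itv_bnd_open_bigcup; apply: eq_bigcup => // k _; rewrite sub0r.
  apply/eqP; rewrite eq_le measure_ge0 andbT.
  pose F k := `]-1, - k.+1%:R^-1 : R]%classic.
  have mF k : measurable (F k : set (measurableTypeR R)) by exact: measurable_itv.
  have mU : measurable (\bigcup_k F k : set (measurableTypeR R)) by exact: bigcup_measurable.
  apply: (le_trans (@measure_sigma_subadditive _ _ _ (lebesgue_stieltjes_measure M) _ F mF mU _)) => //.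
  rewrite eseries0// => k _ _.
  rewrite -[LHS]/(mu `]-1, - k.+1%:R^-1 : R]%classic) muE ?lerN2 ?invf_le1 ?ler1n// !M0 ?subrr//; lra.
have : mu `](-1), y]%classic = (mu `](-1)%R, 0%R[%classic + mu `[0%R, y]%classic)%E.
  rewrite -measureU//.
    congr (mu _); rewrite -itv_bndbnd_setU//; rewrite bnd_simp//; lra.
  apply/seteqP; split=> z //=; rewrite !in_itv/= => -[/andP[_ h] /andP[h' _]]; lra.
rewrite neg0 add0e muE; last lra.
by rewrite [M (-1)]M0 ?subr0// ; lra.
Qed.

Lemma laplace_pair_limit_df (R : realType) (alpha : R)
    (M : cumulativeBounded (0 : R) (1 : R)) : is_limit_df alpha M ->
  exists2 U : R -> R, forall y, 0 <= y -> U y = M y &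
    laplace_pair U (fun lam => 1 - 1 / (1 + lam `^ (- alpha)) `^ (1 / alpha)).
Proof.
move=> [M0 MP].
exists (fun y => fine (lebesgue_stieltjes_measure M (`[0, +oo[%classic `&` [set z | z <= y]))).
  by move=> y y0; rewrite stieltjes_level.
apply: laplace_pair_measure => //.
- by move=> z /=; rewrite in_itv/= andbT.
- move=> lam lam0; rewrite -MP//.
  by under [in RHS]eq_integral do rewrite mulNr.
Qed.

(** * The measure with distribution function y^alpha / Gamma(1 + alpha) *)

Section gamma_integral.
Context (R : realType) (alpha : R).
Hypothesis alpha_itv : 0 < alpha < 1.
Local Notation leb := (@lebesgue_measure R).
Local Notation root t := (t `^ (1 / alpha)).

Let alpha_gt0 : 0 < alpha. Proof. by case/andP: alpha_itv. Qed.

Lemma integral_expR_tail (a : R) :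
  (\int[leb]_(r in `[a, +oo[) (expR (- r))%:E = (expR (- a))%:E)%E.
Proof.
have cexp : continuous (fun r : R => expR (- r)).
  by move=> r; apply: continuous_comp; [exact: continuousN|exact: continuous_expR].
rewrite (@ge0_continuous_FTC2y R _ (fun r => - expR (- r)) a 0)//.
- by rewrite EFinN oppeK add0e.
- exact: continuous_subspaceT.
- by rewrite -oppr0; apply: cvgN; exact: cvgr_expR.
- by apply: cvgN; apply/cvg_at_right_filter; exact: cexp.
- move=> r _; rewrite derive1N// derive1_comp// derive1N// derive1_id mulrN1 derive1E.
  by have /funeqP -> := @derive_expR R; rewrite opprK.
Qed.

Let root_powR (t : R) : 0 <= t -> root t `^ alpha = t.
Proof. by move=> t0; rewrite -powRrM div1r mulVf ?gt_eqF// powRr1. Qed.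

Let powR_root (t : R) : 0 <= t -> root (t `^ alpha) = t.
Proof. by move=> t0; rewrite -powRrM div1r mulfV ?gt_eqF// powRr1. Qed.

Lemma root_le (t y : R) : 0 <= t -> 0 <= y -> (root t <= y) = (t <= y `^ alpha).
Proof.
move=> t0 y0; apply/idP/idP => h.
  rewrite -(root_powR t0); apply: ge0_ler_powR => //; rewrite ?nnegrE ?powR_ge0//.
  exact: ltW.
rewrite -(powR_root y0); apply: ge0_ler_powR => //; rewrite ?nnegrE ?powR_ge0//.
by rewrite div1r invr_ge0 ltW.
Qed.

Lemma root_level (y : R) : 0 <= y ->
  leb (`]0, +oo[%classic `&` [set t | root t <= y]) = (y `^ alpha)%:E.
Proof.
move=> y0.
have -> : `]0, +oo[%classic `&` [set t | root t <= y] = `]0, y `^ alpha]%classic.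
  apply/seteqP; split => t /=; rewrite !in_itv/= ?andbT.
    by case=> t0; rewrite root_le ?(ltW t0)// t0.
  by case/andP => t0; rewrite root_le ?(ltW t0).
rewrite lebesgue_measure_itv/= lte_fin oppr0 adde0; case: ltP => // h.
by congr EFin; apply/eqP; rewrite eq_le h powR_ge0.
Qed.

(* The image of Lebesgue measure by [t |-> t `^ (1 / alpha)] has distribution
   function [y `^ alpha]; Fubini avoids a change of variables in its Laplace
   transform. *)
Lemma laplace_root_fubini (lam : R) : 0 < lam ->
  (\int[leb]_(t in `]0%R, +oo[) (expR (- (lam * root t)))%:E =
   \int[leb]_(r in `]0%R, +oo[) (expR (- r) * (r / lam) `^ alpha)%:E)%E.
Proof.
move=> lam0.
(* expR(- lam root t) is the integral of expR(- r) over r >= lam root t. In the other order the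
   section at r is the set of t with root t <= r/lam, of length (r/lam)^alpha. *)
pose A : set (R * R) := [set z | 0 < z.1 /\ lam * root z.1 <= z.2].
pose g (z : R * R) : \bar R := (\1_A z * expR (- z.2))%:E.
have mA : measurable A.
  have -> : A = (fun z : R * R => (0 < z.1) && (lam * root z.1 <= z.2)) @^-1` [set true].
    by apply/seteqP; split => z /=; rewrite /A /= => /andP.
  rewrite -[X in measurable X]setTI; apply: measurable_and => //.
    exact: measurable_fun_ltr.
  apply: measurable_fun_ler => //; apply: measurable_funM => //.
  exact: (measurableT_comp (measurable_powR _)).
have mg : measurable_fun setT g.
  apply/measurable_EFinP; apply: measurable_funM; first exact: measurable_indic.
  apply: (measurableT_comp (f := @expR R)) => //.
  apply: (measurableT_comp (f := -%R : R -> R)) => //.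
have g0 z : (0 <= g z)%E by rewrite lee_fin mulr_ge0 ?expR_ge0// indicE.
have := @fubini_tonelli _ _ _ _ _ leb leb g mg g0.
have -> : (fun t => \int[leb]_r g (t, r))%E =
    (fun t => (expR (- (lam * root t)))%:E) \_ `]0, +oo[%classic.
  apply/funext => t; rewrite patchE; case: ifPn => [|/negP ht].
    move=> /set_mem; rewrite /= in_itv/= andbT => t0.
    rewrite -integral_expR_tail [RHS]integral_mkcond; apply: eq_integral => r _.
    rewrite /g patchE indicE.
    have -> : ((t, r) \in A) = (r \in `[lam * root t, +oo[%classic).
      by apply/idP/idP => /set_mem H; apply/mem_set; move: H; rewrite /A /= in_itv/= andbT => // -[].
    by case: ifP; rewrite ?mul1r ?mul0r.
  apply: integral0_eq => r _; rewrite /g indicE memNset ?mul0r//.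
  by move=> [/= t0 _]; apply: ht; rewrite inE/= in_itv/= t0.
have -> : (fun r => \int[leb]_t g (t, r))%E =
    (fun r => (expR (- r) * (r / lam) `^ alpha)%:E) \_ `]0, +oo[%classic.
  apply/funext => r; rewrite patchE; case: ifPn => [|/negP hr].
    move=> /set_mem; rewrite /= in_itv/= andbT => r0.
    rewrite EFinM -root_level ?divr_ge0 ?(ltW r0) ?(ltW lam0)//.
    have mB : measurable (`]0, +oo[%classic `&` [set t | root t <= r / lam]).
      apply: measurableI => //; rewrite -[X in measurable X]setTI.
      have -> : [set t | root t <= r / lam] = (fun t => root t) @^-1` `]-oo, r / lam]%classic.
        by apply/seteqP; split => t; rewrite /= in_itv.
      exact: measurable_powR.
    rewrite -[X in leb X]setIT -integral_indic// -ge0_integralZl_EFin ?expR_ge0//; last first.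
      by apply/measurable_EFinP; exact: measurable_indic.
    apply: eq_integral => t _; rewrite /g -EFinM mulrC !indicE; congr (_ * _%:R)%:E.
    congr nat_of_bool; apply/idP/idP => /set_mem H; apply/mem_set; move: H; rewrite /A /= in_itv/= andbT.
      by case=> t0; rewrite mulrC -ler_pdivlMr.
    by case=> t0; rewrite ler_pdivlMr// mulrC.
  apply: integral0_eq => t _; rewrite /g indicE memNset ?mul0r//.
  move=> [/= t0 h]; apply: hr; rewrite inE/= in_itv/= andbT.
  by apply: lt_le_trans h; rewrite mulr_gt0// powR_gt0.
by rewrite -!integral_mkcond.
Qed.

(** As 1/alpha >= 1, root t >= t - 1, and expR(1 - t) dominates. The same finiteness shows that
    [Gamma (1 + alpha)], defined as a real-valued integral, is the true value. *)
Let root_integral_fin :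
  (\int[leb]_(t in `]0%R, +oo[) (expR (- (1 * root t)))%:E)%E \is a fin_num.
Proof.
rewrite ge0_fin_numE; last by apply: integral_ge0 => t _; rewrite lee_fin expR_ge0.
have mexp : measurable_fun setT (fun t : R => (expR (- t))%:E).
  apply/measurable_EFinP; apply: (measurableT_comp (f := @expR R)) => //.
have mroot : measurable_fun setT (fun t => (expR (- (1 * root t)))%:E).
  apply/measurable_EFinP; apply: (measurableT_comp (f := @expR R)) => //.
  apply: (measurableT_comp (f := -%R : R -> R)) => //.
  by apply: measurable_funM => //; exact: measurable_powR.
apply: (@le_lt_trans _ _ ((expR 1)%:E * \int[leb]_(t in `[0%R, +oo[) (expR (- t))%:E)%E).
  rewrite -ge0_integralZl_EFin ?expR_ge0//; last first.
    exact: measurable_funTS.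
  apply: (@le_trans _ _ (\int[leb]_(t in `]0%R, +oo[) ((expR 1)%:E * (expR (- t))%:E))%E).
    apply: ge0_le_integral => //.
    - exact: measurable_funTS.
    - by apply: measurable_funeM; exact: measurable_funTS.
    - move=> t; rewrite /= in_itv/= andbT => t0.
      rewrite -EFinM lee_fin -expRD ler_expR mul1r.
      have [t1|t1] := leP t 1; first by have := powR_ge0 t (1 / alpha); lra.
      have : t <= root t.
        apply: le1r_powR; first exact: ltW.
        by rewrite div1r invf_ge1//; case/andP: alpha_itv => _ /ltW.
      by lra.
  apply: ge0_subset_integral => //.
  - by apply: measurable_funeM; exact: measurable_funTS.
  - by move=> t; rewrite /= !in_itv/= !andbT => /ltW.
by rewrite integral_expR_tail -EFinM ltry.
Qed.

Let Gamma_integrand (lam r : R) : 0 < lam -> 0 < r ->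
  expR (- r) * (r / lam) `^ alpha = lam `^ (- alpha) * (r `^ (1 + alpha - 1) * expR (- r)).
Proof.
move=> lam0 r0; rewrite powRM ?invr_ge0 ?ltW// addrAC subrr add0r.
by rewrite -powR_inv1 ?ltW// -powRrM mulN1r; ring.
Qed.

Let mGamma : measurable_fun (`]0, +oo[%classic : set R)
  (fun r : R => (r `^ (1 + alpha - 1) * expR (- r))%:E).
Proof.
apply: measurable_funTS; apply/measurable_EFinP; apply: measurable_funM.
  exact: measurable_powR.
by apply: (measurableT_comp (f := @expR R)).
Qed.

Let laplace_rootE (lam : R) : 0 < lam ->
  (\int[leb]_(t in `]0%R, +oo[) (expR (- (lam * root t)))%:E =
   (lam `^ (- alpha))%:E *
   \int[leb]_(r in `]0%R, +oo[) (r `^ (1 + alpha - 1) * expR (- r))%:E)%E.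
Proof.
move=> lam0; rewrite laplace_root_fubini// -ge0_integralZl_EFin ?powR_ge0//; last first.
  by move=> r _; rewrite lee_fin mulr_ge0 ?powR_ge0 ?expR_ge0.
apply: eq_integral => r /set_mem; rewrite /= in_itv/= andbT => r0.
by rewrite -EFinM Gamma_integrand.
Qed.

Lemma Gamma_integral :
  (Gamma (1 + alpha))%:E =
  (\int[leb]_(r in `]0%R, +oo[) (r `^ (1 + alpha - 1) * expR (- r))%:E)%E.
Proof.
rewrite /Gamma /Rintegral fineK//.
by have := root_integral_fin; rewrite laplace_rootE// powR1 mul1e.
Qed.

Lemma laplace_root (lam : R) : 0 < lam ->
  (\int[leb]_(t in `]0%R, +oo[) (expR (- (lam * root t)))%:E =
   (Gamma (1 + alpha) * lam `^ (- alpha))%:E)%E.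
Proof. by move=> lam0; rewrite laplace_rootE// -Gamma_integral -EFinM mulrC. Qed.

Lemma Gamma_gt0 : 0 < Gamma (1 + alpha).
Proof.
have := laplace_root (@ltr01 R); rewrite powR1 mulr1 => GE.
rewrite -lte_fin -GE; apply: (@lt_le_trans _ _ ((expR (-1))%:E * 1)%E).
  by rewrite mule1 lte_fin expR_gt0.
have <- : leb (`]0, 1]%classic) = 1%E.
  by rewrite lebesgue_measure_itv/= lte_fin ltr01 oppr0 adde0.
rewrite -integral_cst//.
have mroot : measurable_fun setT (fun t => (expR (- (1 * root t)))%:E).
  apply/measurable_EFinP; apply: (measurableT_comp (f := @expR R)) => //.
  apply: (measurableT_comp (f := -%R : R -> R)) => //.
  by apply: measurable_funM => //; exact: measurable_powR.
apply: (@le_trans _ _ (\int[leb]_(t in `]0%R, 1%R]) (expR (- (1 * root t)))%:E)%E).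
  apply: ge0_le_integral => //.
  - by move=> t _; rewrite lee_fin expR_ge0.
  - exact: measurable_funTS.
  - move=> t; rewrite /= in_itv/= => /andP[t0 t1].
    by rewrite lee_fin ler_expR mul1r lerN2 root_le ?(ltW t0)// powR1.
apply: ge0_subset_integral => //.
- exact: measurable_funTS.
- by move=> t; rewrite /= !in_itv/= => /andP[->].
Qed.

Lemma laplace_pair_power : exists2 U : R -> R,
  (forall y, 0 <= y -> U y = y `^ alpha / Gamma (1 + alpha)) &
  laplace_pair U (fun lam => lam `^ (- alpha)).
Proof.
have G0 := Gamma_gt0.
have LP : laplace_pair (fun y => fine (leb (`]0, +oo[%classic `&` [set t | root t <= y])))
    (fun lam => Gamma (1 + alpha) * lam `^ (- alpha)).
  apply: laplace_pair_measure => //.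
  - by apply: measurable_funTS; exact: measurable_powR.
  - by move=> t _; exact: powR_ge0.
  - exact: laplace_root.
have := laplace_pairZ G0 LP.
rewrite (_ : (fun l => Gamma (1 + alpha) * l `^ (- alpha) / Gamma (1 + alpha)) =
   (fun lam => lam `^ (- alpha))); last first.
  by apply/funext => l; rewrite mulrC mulKf// gt_eqF.
move=> ?; eexists; last by eassumption.
by move=> y y0 /=; rewrite root_level.
Qed.

End gamma_integral.

(** * The most recent common ancestor *)

Section population_laws.
Context (R : realType) (d : measure_display) (T : measurableType d)
  (P : probability T R) (xi : {RV P >-> nat}) (X : seq nat -> {RV P >-> nat}).
Hypothesis iidX : iid_copies xi X.
Hypothesis mean1 : ('E_P[fun w => (xi w)%:R : R] = 1)%E.

Local Notation f := (pgf xi).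
Local Notation tree := (family_tree X).
Local Notation Z n w := (popsize (tree w) n).

Lemma measurable_local_event (n : nat) (b : offspring -> bool) :
  (forall off off', trunc n off = trunc n off' -> b off = b off') ->
  measurable [set w | b (tree w)].
Proof.
move=> bloc; rewrite -[X in measurable X]setTI.
have -> : [set w | b (tree w)] = (fun w => b (tree w)) @^-1` [set true].
  by apply/seteqP; split.
exact: (measurable_local X bloc).
Qed.

Lemma integral_local_event (n : nat) (b : offspring -> bool) :
  (forall off off', trunc n off = trunc n off' -> b off = b off') ->
  (\int[P]_w ((b (tree w))%:R : R)%:E = P [set w | b (tree w)])%E.
Proof.
move=> /measurable_local_event mb.
rewrite -[X in P X]setIT -integral_indic//; apply: eq_integral => w _.
rewrite indicE; congr (_%:R)%:E; congr nat_of_bool.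
by apply/idP/idP => [/mem_set//|/set_mem].
Qed.

Lemma popsize_gt0_measurable (n : nat) : measurable [set w | (0 < Z n w)%N].
Proof.
apply: (@measurable_local_event n (fun off => (0 < popsize off n)%N)) => off off' e.
by rewrite (popsize_local (leqnn n) e).
Qed.

(** On extinction s^Z(n) equals 1, so subtracting f_n(0) from f_n(s) restricts the transform to Z(n)
    > 0. *)
Lemma laplace_pair_popsize (n : nat) (a : R) : 0 <= a ->
  laplace_pair
    (fun y => fine (P ([set w | (0 < Z n w)%N] `&` [set w | a * (Z n w)%:R <= y])))
    (fun lam => iter n f (expR (- (lam * a))) - iter n f 0).
Proof.
move=> a0; have mZ (g : nat -> R) : measurable_fun setT (fun w => g (Z n w)).
  apply: (measurable_local X (n := n) (V := fun off => g (popsize off n))) => off off' e.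
  by rewrite (popsize_local (leqnn n) e).
apply: laplace_pair_measure.
- exact: popsize_gt0_measurable.
- exact: measurable_funTS (mZ (fun k => a * k%:R)).
- by move=> w _; rewrite mulr_ge0.
move=> lam lam0; set s := expR (- (lam * a)).
have s01 : 0 <= s <= 1.
  by rewrite expR_ge0 -expR0 ler_expR oppr_le0 mulr_ge0// ltW.
have sZ w : expR (- (lam * (a * (Z n w)%:R))) = s ^+ Z n w.
  by rewrite /s -expRM_natl; congr expR; ring.
under eq_integral do rewrite sZ.
have H := integral_popsize iidX n s01.
have H0 := prob_extinct iidX n.
have decE : (\int[P]_w (s ^+ Z n w)%:E = \int[P]_(w in [set w | (0 < Z n w)%N]) (s ^+ Z n w)%:E +
    \int[P]_w ((Z n w == 0%N)%:R : R)%:E)%E.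
  rewrite [X in (X + _)%E]integral_mkcond -ge0_integralD//.
  - apply: eq_integral => w _; rewrite patchE.
    have -> : (w \in [set w | (0 < Z n w)%N]) = (0 < Z n w)%N.
      by apply/idP/idP => [/set_mem//|/mem_set].
    by case: (Z n w) => [|k] /=; rewrite ?expr0 ?add0e ?adde0.
  - by move=> w _; apply: erestrict_ge0 => w' _; rewrite lee_fin exprn_ge0; case/andP: s01.
  - apply/(measurable_restrictT _ _).1; first exact: popsize_gt0_measurable.
    by apply/measurable_EFinP; apply: measurable_funTS; exact: (mZ (fun k => s ^+ k)).
  - by apply/measurable_EFinP; exact: (mZ (fun k => (k == 0%N)%:R)).
rewrite H H0 in decE.
by rewrite EFinB decE addeK.
Qed.

Definition ancestor_prob (pr : pred nat) (m n : nat) : R :=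
  fine (P [set w | one_ancestor pr m n (tree w)]).

Lemma ancestor_probE (pr : pred nat) (m n : nat) : (m <= n)%N ->
  (\int[P]_w ((one_ancestor pr m n (tree w))%:R : R)%:E = (ancestor_prob pr m n)%:E)%E.
Proof.
move=> mn; have loc off off' : trunc n off = trunc n off' ->
    one_ancestor pr m n off = one_ancestor pr m n off' by exact: one_ancestor_local.
rewrite (integral_local_event loc) fineK// fin_num_measure//.
exact: measurable_local_event loc.
Qed.

Lemma ancestor_prob_ge0 (pr : pred nat) (m n : nat) : 0 <= ancestor_prob pr m n.
Proof. by rewrite fine_ge0. Qed.

Lemma ancestor_probS (pr : pred nat) (m n : nat) : (m <= n)%N -> ~~ pr 0%N ->
  ancestor_prob pr m.+1 n.+1 = dpgf xi (iter n f 0) * ancestor_prob pr m n.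
Proof.
move=> mn pr0; apply: EFin_inj; rewrite -ancestor_probE//.
by rewrite (integral_one_ancestor iidX mn pr0 (ancestor_probE pr mn) mean1).
Qed.

Let q_itv n : 0 <= iter n f 0 <= 1.
Proof. by apply: iter_pgf_itv; rewrite lexx ler01. Qed.

Let incr n := iter n.+1 f 0 - iter n f 0.

Lemma ancestor_prob_le (pr : pred nat) (m k : nat) : ~~ pr 0%N ->
  ancestor_prob pr m (m + k) * incr k <= ancestor_prob pr 0 k * incr (m + k)%N.
Proof.
move=> pr0; elim: m => [//|m IHm]; rewrite addSn ancestor_probS ?leq_addr//.
set b := dpgf _ _; have b0 : 0 <= b by exact: dpgf_ge0.
rewrite -mulrA; apply: (le_trans (ler_wpM2l b0 IHm)).
rewrite mulrCA ler_wpM2l ?ancestor_prob_ge0//.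
(* The supporting line at f_j(0), j = m + k, evaluated at the next iterate, gives f'(f_j(0))
   [incr j] <= [incr j.+1], and the bounds telescope in m. *)
have := pgf_support_line mean1 (q_itv (m + k)) (q_itv (m + k).+1).
by rewrite -/b /incr [iter (m + k).+2 f 0]iterS [iter (m + k).+1 f 0]iterS; lra.
Qed.

(** Here each supporting line is evaluated at the previous iterate, so the increments trail by one
    index; this is the source of gap(n-1) and gap(k-1) later on. *)
Lemma ancestor_prob_ge (pr : pred nat) (m k : nat) : ~~ pr 0%N ->
  ancestor_prob pr 0 k.+1 * incr (m + k)%N <= ancestor_prob pr m (m + k.+1) * incr k.
Proof.
move=> pr0; elim: m => [//|m IHm]; rewrite !addnS !addSn in IHm *.
rewrite ancestor_probS ?leqW ?leq_addr//; set b := dpgf _ _; have b0 : 0 <= b by exact: dpgf_ge0.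
rewrite -mulrA; apply: le_trans (ler_wpM2l b0 IHm).
rewrite mulrCA ler_wpM2l ?ancestor_prob_ge0//.
have := pgf_support_line mean1 (q_itv (m + k).+1) (q_itv (m + k)).
rewrite -/b /incr [iter (m + k).+2 f 0]iterS [iter (m + k).+1 f 0]iterS; lra.
Qed.

End population_laws.

(** * The conditional limit law *)

Section conditional_limit.
Context (R : realType) (d : measure_display) (T : measurableType d)
  (P : probability T R) (xi : {RV P >-> nat}) (X : seq nat -> {RV P >-> nat})
  (alpha : R) (L : R -> R) (phi : nat -> R) (M : cumulativeBounded (0 : R) (1 : R)).
Hypothesis alpha_itv : 0 < alpha < 1.
Hypothesis iidX : iid_copies xi X.
Hypothesis mean1 : ('E_P[fun w => ((xi w)%:R)%R] = 1)%E.
Hypothesis svL : slowly_varying_at0 L.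
Hypothesis fE : forall s : R, 0 <= s <= 1 ->
  pgf xi s = s + (1 - s) `^ (1 + alpha) * L (1 - s).
Hypothesis phi_cvgy : phi n @[n --> \oo] --> +oo.
Hypothesis phi_small : phi n / n%:R @[n --> \oo] --> (0 : R).
Hypothesis limM : is_limit_df alpha M.

Local Notation f := (pgf xi).
Local Notation tree := (family_tree X).
Local Notation Z n w := (popsize (tree w) n).
Local Notation Q n := (surv f n).
Local Notation elQ n := (ell L alpha (Q n)).
Local Notation gap n := (Q n * elQ n).
Local Notation m n := (Num.truncn (phi n)).
Local Notation k c n := (Num.truncn (c * phi n)).

Let alpha_gt0 : 0 < alpha. Proof. by case/andP: alpha_itv. Qed.
Let f_itv := @pgf_itv R d T P xi.
Let df_ge0 := dpgf_ge0 mean1.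
Let f_support := pgf_support_line mean1.

Let Q_gt0 n : 0 < Q n. Proof. exact: surv_gt0 alpha_gt0 df_ge0 f_support svL fE n. Qed.

Let gap_gt0 n : 0 < gap n.
Proof. exact: gap_gt0 alpha_gt0 df_ge0 f_support svL fE n. Qed.

Let ellQ_gt0 n : 0 < elQ n.
Proof. by have := gap_gt0 n; rewrite pmulr_rgt0. Qed.

Let gapE n : iter n.+1 f 0 - iter n f 0 = gap n.
Proof.
have := survS alpha_gt0 df_ge0 f_support svL fE n.
by rewrite !iter_f0; lra.
Qed.

Let phi_gt0 : \forall n \near \oo, 0 < phi n.
Proof. by move/cvgryPgt: phi_cvgy; apply. Qed.

Let k_cvgy (c : R) : 0 < c -> k c n @[n --> \oo] --> \oo.
Proof. by move=> c0; exact: truncn_cvgy. Qed.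

Let m_cvgy : m n @[n --> \oo] --> \oo.
Proof.
have := k_cvgy ltr01; rewrite (_ : (fun n => k 1 n) = (fun n => m n))//.
by apply/funext => n; rewrite mul1r.
Qed.

Let m_phi : (m n)%:R / phi n @[n --> \oo] --> (1 : R).
Proof.
have := truncn_cvg_ratio ltr01 phi_cvgy.
rewrite (_ : (fun n => (k 1 n)%:R / phi n) = (fun n => (m n)%:R / phi n))//.
by apply/funext => n; rewrite mul1r.
Qed.

Let k_m (c : R) : 0 < c -> (k c n)%:R / (m n)%:R @[n --> \oo] --> c.
Proof.
move=> c0.
have H : (k c n)%:R / phi n * ((m n)%:R / phi n)^-1 @[n --> \oo] --> c * 1^-1.
  by apply: cvgM; [exact: truncn_cvg_ratio|apply: (cvgV (oner_neq0 R)); exact: m_phi].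
rewrite invr1 mulr1 in H; apply: cvg_trans H; apply: near_eq_cvg; near=> n.
have p0 : 0 < phi n by near: n.
have m0 : (0 < m n)%N by near: n; move/cvgnyPgt: m_cvgy; apply.
have m0' : (0 : R) < (m n)%:R by rewrite ltr0n.
by rewrite /=; field; rewrite !lt0r_neq0.
Unshelve. all: by end_near. Qed.

Let trunc_small (u : nat -> nat) (c : R) : (u n)%:R / phi n @[n --> \oo] --> c ->
  (u n)%:R / n%:R @[n --> \oo] --> (0 : R).
Proof.
move=> uc; have H : (u n)%:R / phi n * (phi n / n%:R) @[n --> \oo] --> c * 0.
  by apply: cvgM.
rewrite mulr0 in H; apply: cvg_trans H; apply: near_eq_cvg; near=> n.
have p0 : 0 < phi n by near: n.
by rewrite /= mulrA divfK// gt_eqF.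
Unshelve. all: by end_near. Qed.

Let k_range (c : R) : 0 < c -> \forall n \near \oo, (1 < k c n <= n)%N.
Proof.
move=> c0; near=> n; apply/andP; split.
  by near: n; move/cvgnyPgt: (k_cvgy c0); apply.
have n0 : (0 < n)%N by near: n; exists 1%N.
rewrite -(ler_nat R) -[leRHS]mul1r -ler_pdivrMr ?ltr0n//.
near: n; apply: (cvgr_le _ (trunc_small (truncn_cvg_ratio c0 phi_cvgy))).
exact: ltr01.
Unshelve. all: by end_near. Qed.

Definition level_prob (a : R) (n : nat) (y : R) : R :=
  fine (P ([set w | (0 < Z n w)%N] `&` [set w | a * (Z n w)%:R <= y])).

(** The asymptotics of P(H(n)). The limit y^alpha/Gamma(1+alpha) is continuous at y = 1, so levels
    just below and just above 1 pin down the value at 1. *)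
Lemma level_prob_small_value :
  level_prob (Q (m n)) n 1 / ((m n)%:R * gap n) @[n --> \oo] --> (Gamma (1 + alpha))^-1.
Proof.
have [U UE UP] := laplace_pair_power alpha_itv.
have G0 := Gamma_gt0 alpha_itv.
have pairs : \forall n \near \oo, laplace_pair
    (fun y => level_prob (Q (m n)) n y / ((m n)%:R * gap n))
    (fun lam => (iter n f (expR (- (lam * Q (m n)))) - iter n f 0) / ((m n)%:R * gap n)).
  near=> n; apply: (laplace_pairZ (U := level_prob _ n)).
    rewrite mulr_gt0// ltr0n; near: n; move/cvgnyPgt: m_cvgy; apply.
  by apply: (laplace_pair_popsize iidX); exact: ltW.
have cvgPsi lam : 0 < lam ->
    (iter n f (expR (- (lam * Q (m n)))) - iter n f 0) / ((m n)%:R * gap n)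
      @[n --> \oo] --> lam `^ (- alpha).
  move=> lam0; apply: (small_value_laplace alpha_gt0 f_itv df_ge0 f_support svL fE) => //.
  exact: trunc_small m_phi.
have K := laplace_continuity pairs UP cvgPsi.
have Ucont : y `^ alpha / Gamma (1 + alpha) @[y --> (1 : R)] --> (Gamma (1 + alpha))^-1.
  rewrite -[X in _ --> X]mul1r; apply: cvgMl.
  have : {for 1, continuous (fun z : R => z `^ alpha)}.
    apply: differentiable_continuous; apply/derivable1_diffP.
    by have [] := is_derive1_powR alpha (@ltr01 R).
  by rewrite /prop_for /continuous_at powR1.
apply: cvgr_bounds => e e0; have e2 : 0 < e / 2 by rewrite divr_gt0.
  have /cvgrPdist_le/(_ _ e2) [r /= r0 B] := Ucont.
  pose y0 : R := Num.max (1 - r / 2) 2^-1.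
  have y00 : 0 < y0 by rewrite lt_max invr_gt0 ltr0n orbT.
  have y01 : y0 < 1.
    by rewrite gt_max gtrBl divr_gt0//= invf_lt1 ?ltr1n.
  have ry : 1 - r < y0 by rewrite lt_max ltrD2l ltrN2 ltr_pdivrMr// ltr_pMr// ltr1n.
  have h : (Gamma (1 + alpha))^-1 - e / 2 <= y0 `^ alpha / Gamma (1 + alpha).
    have : `|1 - y0| < r by rewrite gtr0_norm ?subr_gt0//; lra.
    by move/B; rewrite ler_distlC => /andP[].
  have y01' : 0 < y0 < 1 by rewrite y00.
  have := K y0 1 (e / 2) y01' e2; apply: filterS => n [_].
  by rewrite UE ?(ltW y00)//; lra.
have /cvgrPdist_le/(_ _ e2) [r /= r0 B] := Ucont.
pose y1 : R := 1 + r / 2.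
have y11 : 0 < (1 : R) < y1 by rewrite ltr01 ltrDl divr_gt0.
have h : y1 `^ alpha / Gamma (1 + alpha) <= (Gamma (1 + alpha))^-1 + e / 2.
  have : `|1 - y1| < r.
    rewrite /y1 opprD addrA subrr sub0r normrN gtr0_norm ?divr_gt0//.
    by rewrite ltr_pdivrMr// ltr_pMr// ltr1n.
  by move/B; rewrite ler_distlC => /andP[].
have := K 1 y1 (e / 2) y11 e2; apply: filterS => n [+ _].
rewrite UE; last by case/andP: y11 => _; lra.
by lra.
Unshelve. all: by end_near. Qed.

Let surv_k_m (c : R) : 0 < c ->
  Q (k c n) / Q (m n) @[n --> \oo] --> c `^ (- (1 / alpha)).
Proof.
move=> c0; apply: (surv_ratio alpha_gt0 df_ge0 f_support svL fE c0) => //.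
  exact: k_cvgy.
exact: k_m.
Qed.

(** Convergence of the law of Q(u) Z(u) given survival, with the denominator Q(u) multiplied out; a
    jump of M may lie at either level. *)
Lemma level_prob_limit_df (y0 y1 e : R) (u : nat -> nat) : 0 < y0 < y1 -> 0 < e ->
  u n @[n --> \oo] --> \oo ->
  \forall n \near \oo, level_prob (Q (u n)) (u n) y0 <= Q (u n) * (M y1 + e) /\
    Q (u n) * (M y0 - e) <= level_prob (Q (u n)) (u n) y1.
Proof.
move=> /[dup] y01 /andP[y00 y01'] e0 u_cvgy.
have [U UE UP] := laplace_pair_limit_df limM.
have pairs : \forall n \near \oo, laplace_pair
    (fun y => level_prob (Q n) n y / Q n)
    (fun lam => (iter n f (expR (- (lam * Q n))) - iter n f 0) / Q n).
  apply: nearW => n; apply: (laplace_pairZ (U := level_prob _ n)) => //.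
  by apply: (laplace_pair_popsize iidX); exact: ltW.
have cvgPsi lam := conditional_laplace alpha_gt0 f_itv df_ge0 f_support svL fE (lam := lam).
have K := laplace_continuity pairs UP cvgPsi y01 e0.
have Ku : \forall n \near \oo, level_prob (Q (u n)) (u n) y0 / Q (u n) <= U y1 + e /\
    U y0 - e <= level_prob (Q (u n)) (u n) y1 / Q (u n) := u_cvgy _ K.
move: Ku; apply: filterS => n /= [].
rewrite !UE ?(ltW y00)//; last exact: ltW (lt_trans y00 y01').
by rewrite ler_pdivrMr// ler_pdivlMr// ![_ * Q _]mulrC.
Qed.

Let level_setE (a y : R) (n : nat) :
  [set w | (0 < Z n w)%N] `&` [set w | a * (Z n w)%:R <= y] =
  [set w | (0 < Z n w)%N && (a * (Z n w)%:R <= y)].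
Proof. by apply/seteqP; split => w /= /andP. Qed.

Let level_set_measurable (a y : R) (n : nat) :
  measurable [set w | (0 < Z n w)%N && (a * (Z n w)%:R <= y)].
Proof.
apply: (measurable_local_event (n := n) X
  (b := fun off => (0 < popsize off n)%N && (a * (popsize off n)%:R <= y))).
by move=> off off' e; rewrite (popsize_local (leqnn n) e).
Qed.

(* [Q b * Z <= 1] is equivalent to [Q a * Z <= Q a / Q b]. *)
Let level_prob_mono (a b : nat) (y : R) (n : nat) : Q a / Q b <= y ->
  level_prob (Q b) n 1 <= level_prob (Q a) n y.
Proof.
move=> aby; rewrite /level_prob !level_setE fine_le ?fin_num_measure//.
apply: le_measure; rewrite ?inE//= => w /= /andP[-> h] /=.
apply: le_trans aby; rewrite ler_pdivlMr// -mulrA [_ * Q b]mulrC.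
by rewrite -[leRHS]mulr1 ler_wpM2l// ltW.
Qed.

Let level_prob_mono_ge (a b : nat) (y : R) (n : nat) : y <= Q a / Q b ->
  level_prob (Q a) n y <= level_prob (Q b) n 1.
Proof.
move=> aby; rewrite /level_prob !level_setE fine_le ?fin_num_measure//.
apply: le_measure; rewrite ?inE//= => w /= /andP[-> h] /=.
have := le_trans h aby; rewrite ler_pdivlMr// -mulrA [_ * Q b]mulrC.
by rewrite -[leRHS]mulr1 ler_pM2l.
Qed.

Let cond_pred (n : nat) : pred nat := fun z => (0 < z)%N && (Q (m n) * z%:R <= 1).

Definition recent_mrca (x : R) (n : nat) : set T :=
  [set w | (mrca_dist (tree w) n)%:R <= x * phi n].

Definition small_population (n : nat) : set T := [set w | 0 < Q (m n) * (Z n w)%:R <= 1].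

Let small_populationE n : small_population n = [set w | (0 < Z n w)%N && (Q (m n) * (Z n w)%:R <= 1)].
Proof.
by apply/seteqP; split => w /=; rewrite /small_population /= pmulr_rgt0// ltr0n.
Qed.

Lemma prob_small_population n : fine (P (small_population n)) = level_prob (Q (m n)) n 1.
Proof. by rewrite small_populationE /level_prob level_setE. Qed.

Lemma recent_mrca_smallE (x : R) (n : nat) : 0 < x * phi n -> (1 < k x n <= n)%N ->
  recent_mrca x n `&` small_population n = [set w | one_ancestor (cond_pred n) (n - k x n) n (tree w)].
Proof.
move=> xp /andP[k1 kn]; rewrite small_populationE; apply/seteqP; split => w /=.
  rewrite /recent_mrca /= -truncn_ge_nat ?(ltW xp)// => -[h /andP[Z0 h1]].
  by rewrite /one_ancestor -mrca_dist_leq ?(ltnW k1)// h /cond_pred Z0.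
rewrite /one_ancestor => /andP[h /andP[Z0 h1]].
rewrite Z0 h1; split => //.
by rewrite /recent_mrca /= -truncn_ge_nat ?(ltW xp)// mrca_dist_leq ?(ltnW k1).
Qed.

Let ancestor_prob0 n j : ancestor_prob X (cond_pred n) 0 j = level_prob (Q (m n)) j 1.
Proof.
rewrite /ancestor_prob /level_prob level_setE; congr (fine (P _)).
apply/seteqP; split => w /=; rewrite /one_ancestor reduced_popsize0 /cond_pred.
  by case/andP => _.
by move=> /andP[-> ->].
Qed.

(** The single ancestor starts a population of age k, which is still measured at the scale Q(m) of
    the conditioning event; [level_prob_mono] later changes the scale to Q(k). *)
Lemma recent_mrca_prob_le (x : R) (n : nat) : 0 < x * phi n -> (1 < k x n <= n)%N ->
  fine (P (recent_mrca x n `&` small_population n)) * gap (k x n) <=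
  level_prob (Q (m n)) (k x n) 1 * gap n.
Proof.
move=> xp kr; rewrite recent_mrca_smallE// -ancestor_prob0.
have pr0 : ~~ cond_pred n 0%N by [].
have := ancestor_prob_le iidX mean1 (n - k x n) (k x n) pr0.
by rewrite subnK ?gapE//; case/andP: kr.
Qed.

Lemma recent_mrca_prob_ge (x : R) (n : nat) : 0 < x * phi n -> (1 < k x n <= n)%N ->
  level_prob (Q (m n)) (k x n) 1 * gap n.-1 <=
  fine (P (recent_mrca x n `&` small_population n)) * gap (k x n).-1.
Proof.
move=> xp kr; rewrite recent_mrca_smallE// -ancestor_prob0.
have pr0 : ~~ cond_pred n 0%N by [].
have := ancestor_prob_ge iidX mean1 (n - k x n) (k x n).-1 pr0.
have /andP[k1 kn] := kr; have k0 := ltnW k1.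
rewrite !gapE prednK// subnK//.
suff -> : (n - k x n + (k x n).-1 = n.-1)%N by [].
by rewrite -(subn1 (k x n)) (addnBA _ k0) (subnK kn) subn1.
Qed.

Lemma recent_mrca_mono (x x' : R) (n : nat) : 0 < phi n -> 0 < x' -> x' <= x ->
  (1 < k x n <= n)%N -> (1 < k x' n <= n)%N ->
  fine (P (recent_mrca x' n `&` small_population n)) <= fine (P (recent_mrca x n `&` small_population n)).
Proof.
move=> p0 x'0 x'x kr kr'; have x0 : 0 < x by exact: lt_le_trans x'x.
have loc y : measurable [set w | one_ancestor (cond_pred n) (n - y)%N n (tree w)].
  apply: (measurable_local_event (n := n) X) => off off' e.
  by apply: one_ancestor_local => //; exact: leq_subr.
rewrite fine_le//.
- by rewrite recent_mrca_smallE ?mulr_gt0// fin_num_measure//; exact: loc.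
- by rewrite recent_mrca_smallE ?mulr_gt0// fin_num_measure//; exact: loc.
apply: le_measure; rewrite ?inE.
- by rewrite recent_mrca_smallE ?mulr_gt0//; exact: loc.
- by rewrite recent_mrca_smallE ?mulr_gt0//; exact: loc.
by move=> w [h Hw]; split => //; apply: (le_trans h); rewrite ler_pM2r.
Qed.

Local Notation B n := (level_prob (Q (m n)) n 1).
Local Notation factor c n := (Q (k c n) / gap (k c n) * (gap n / B n)).

Let B_gt0 : \forall n \near \oo, 0 < B n.
Proof.
have G0 : 0 < (Gamma (1 + alpha))^-1 by rewrite invr_gt0; exact: Gamma_gt0.
near=> n.
have m0 : (0 : R) < (m n)%:R by rewrite ltr0n; near: n; move/cvgnyPgt: m_cvgy; apply.
have : 0 < B n / ((m n)%:R * gap n).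
  by near: n; apply: (cvgr_gt _ level_prob_small_value).
by rewrite pmulr_lgt0// invr_gt0 mulr_gt0.
Unshelve. all: by end_near. Qed.

(** [factor] is what multiplies the value of M in the quotient. Q(k)/gap(k) is the inverse of [elQ],
    about alpha k; gap(n)/B(n) is about Gamma(1+alpha)/m; and k/m tends to c. *)
Let factor_cvg (c : R) : 0 < c ->
  factor c n @[n --> \oo] --> alpha * c * Gamma (1 + alpha).
Proof.
move=> c0; have G0 := Gamma_gt0 alpha_itv.
have a0 : alpha^-1 != 0 by rewrite invr_eq0 gt_eqF.
have ka := cvg_comp _ _ (k_cvgy c0) (ell_surv_asymp alpha_gt0 df_ge0 f_support svL fE).
have H : ((k c n)%:R * elQ (k c n))^-1 * ((k c n)%:R / (m n)%:R) *
    (B n / ((m n)%:R * gap n))^-1 @[n --> \oo] -->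
    alpha^-1^-1 * c * (Gamma (1 + alpha))^-1^-1.
  apply: cvgM; first by apply: cvgM; [exact: (cvgV a0 ka)|exact: k_m].
  by apply: cvgV level_prob_small_value; rewrite invr_eq0 gt_eqF.
rewrite !invrK in H; apply: cvg_trans H; apply: near_eq_cvg; near=> n.
have m0 : (0 : R) < (m n)%:R by rewrite ltr0n; near: n; move/cvgnyPgt: m_cvgy; apply.
have k0 : (0 : R) < (k c n)%:R by rewrite ltr0n; near: n; move/cvgnyPgt: (k_cvgy c0); apply.
have b0 : 0 < B n by near: n.
have q0 := Q_gt0 n; have q0' := Q_gt0 (k c n).
have l0 := ellQ_gt0 n; have l0' := ellQ_gt0 (k c n).
move: (B n) b0 => b b0; move: (elQ n) l0 => l l0; move: (elQ (k c n)) l0' => l' l0'.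
by rewrite /=; field; rewrite !lt0r_neq0.
Unshelve. all: by end_near. Qed.

Let pred_ratio (u : nat -> nat) : u n @[n --> \oo] --> \oo ->
  gap (u n).-1 / gap (u n) @[n --> \oo] --> (1 : R).
Proof.
move=> uoo; apply: (gap_ratio alpha_gt0 df_ge0 f_support svL fE (k := fun n => (u n).-1)) => //.
  apply/cvgnyPge => N; near=> n.
  have : (N.+1 <= u n)%N by near: n; move/cvgnyPge: uoo; apply.
  by case: (u n).
have H : 1 - (u n)%:R^-1 @[n --> \oo] --> (1 - 0 : R).
  apply: cvgB; first exact: cvg_cst.
  apply/gtr0_cvgV0; last exact/cvgrnyP.
  by near=> n; rewrite ltr0n; near: n; move/cvgnyPgt: uoo; apply.
rewrite subr0 in H; apply: cvg_trans H; apply: near_eq_cvg; near=> n.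
have : (0 < u n)%N by near: n; move/cvgnyPgt: uoo; apply.
case: (u n) => // j _ /=.
have -> : (j%:R : R) = j.+1%:R - 1 by rewrite -natr1 addrK.
by rewrite mulrBl mulfV ?pnatr_eq0// mul1r.
Unshelve. all: by end_near. Qed.

Let shifted_factor_cvg (c : R) : 0 < c ->
  Q (k c n) / gap (k c n).-1 * (gap n.-1 / B n) @[n --> \oo] -->
    alpha * c * Gamma (1 + alpha).
Proof.
move=> c0; have H : factor c n * ((gap (k c n).-1 / gap (k c n))^-1 * (gap n.-1 / gap n))
    @[n --> \oo] --> alpha * c * Gamma (1 + alpha) * (1^-1 * 1).
  apply: cvgM; first exact: factor_cvg.
  apply: cvgM; first by apply: (cvgV (oner_neq0 R)); exact: pred_ratio (k_cvgy c0).
  by apply: (pred_ratio (u := id)).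
rewrite invr1 !mulr1 in H; apply: cvg_trans H; apply: near_eq_cvg; near=> n.
have b0 : 0 < B n by near: n.
have g1 := gap_gt0 n; have g2 := gap_gt0 (k c n); have g3 := gap_gt0 (k c n).-1.
move: (B n) b0 => b b0; move: (gap n) g1 => x1 g1; move: (gap (k c n)) g2 => x2 g2.
move: (gap (k c n).-1) g3 => x3 g3.
by rewrite /=; field; rewrite !lt0r_neq0.
Unshelve. all: by end_near. Qed.

Let M_ge0 (y : R) : 0 <= M y.
Proof.
have [M0 _] := limM; have [y0|y0] := ltP y 0; first by rewrite M0.
have Mm1 : M (-1) = 0 by apply: M0; rewrite oppr_lt0.
rewrite -[leLHS]Mm1; apply: cumulative_is_nondecreasing.
by rewrite (le_trans _ y0)// lerN10.
Qed.

Let near_range (c : R) : 0 < c -> \forall n \near \oo,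
  [/\ 0 < phi n, 0 < c * phi n, (1 < k c n <= n)%N & 0 < B n].
Proof.
move=> c0; near=> n.
have p0 : 0 < phi n by near: n.
by split; rewrite ?mulr_gt0//; near: n; [exact: k_range|].
Unshelve. all: by end_near. Qed.

Let recent_mrca_ratio_le (x y1 e : R) : 0 < x -> x `^ (- (1 / alpha)) < y1 -> 0 < e ->
  \forall n \near \oo, fine (P (recent_mrca x n `&` small_population n)) / B n <= (M y1 + e) * factor x n.
Proof.
move=> x0 yy1 e0; set y := x `^ _ in yy1.
have y0 : 0 < y by exact: powR_gt0.
(* Room for two moves: Q(k)/Q(m) tends to y and is eventually below z, and the passage to M goes
   from level z to level y1. *)
pose z := (y + y1) / 2.
have yz : y < z by rewrite ltr_pdivlMr//; lra.
have zy1 : z < y1 by rewrite ltr_pdivrMr//; lra.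
have zz : 0 < z < y1 by rewrite zy1 (lt_trans y0).
near=> n.
have [p0 xp kr b0] : [/\ 0 < phi n, 0 < x * phi n, (1 < k x n <= n)%N & 0 < B n].
  by near: n; exact: near_range.
have g0 := gap_gt0 (k x n).
have qz : Q (k x n) / Q (m n) <= z by near: n; exact: (cvgr_le _ (surv_k_m x0)).
have [h _] : level_prob (Q (k x n)) (k x n) z <= Q (k x n) * (M y1 + e) /\
    Q (k x n) * (M z - e) <= level_prob (Q (k x n)) (k x n) y1.
  by near: n; apply: level_prob_limit_df => //; exact: k_cvgy.
have h2 := le_trans (level_prob_mono (k x n) qz) h.
have h3 : fine (P (recent_mrca x n `&` small_population n)) <= Q (k x n) * (M y1 + e) * gap n / gap (k x n).
  rewrite ler_pdivlMr//; apply: (le_trans (recent_mrca_prob_le xp kr)).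
  by rewrite ler_pM2r.
apply: (@le_trans _ _ (Q (k x n) * (M y1 + e) * gap n / gap (k x n) / B n)).
  by rewrite ler_pM2r ?invr_gt0.
rewrite le_eqVlt; apply/orP; left; apply/eqP; ring.
Unshelve. all: by end_near. Qed.

Let recent_mrca_ratio_ge (x y0 e : R) : 0 < x -> 0 < y0 < x `^ (- (1 / alpha)) -> 0 < e ->
  \forall n \near \oo, (M y0 - e) * (Q (k x n) / gap (k x n).-1 * (gap n.-1 / B n)) <=
     fine (P (recent_mrca x n `&` small_population n)) / B n.
Proof.
move=> x0 /andP[y00 yy] e0; set y := x `^ _ in yy.
pose z := (y0 + y) / 2.
have yz : z < y by rewrite ltr_pdivrMr//; lra.
have zy1 : y0 < z by rewrite ltr_pdivlMr//; lra.
have zz : 0 < y0 < z by rewrite y00.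
near=> n.
have [p0 xp kr b0] : [/\ 0 < phi n, 0 < x * phi n, (1 < k x n <= n)%N & 0 < B n].
  by near: n; exact: near_range.
have g0 := gap_gt0 (k x n).-1.
have qz : z <= Q (k x n) / Q (m n) by near: n; exact: (cvgr_ge _ (surv_k_m x0)).
have [_ h] : level_prob (Q (k x n)) (k x n) y0 <= Q (k x n) * (M z + e) /\
    Q (k x n) * (M y0 - e) <= level_prob (Q (k x n)) (k x n) z.
  by near: n; apply: level_prob_limit_df => //; exact: k_cvgy.
have h2 := le_trans h (level_prob_mono_ge (k x n) qz).
have h3 : Q (k x n) * (M y0 - e) * gap n.-1 / gap (k x n).-1 <= fine (P (recent_mrca x n `&` small_population n)).
  rewrite ler_pdivrMr//; apply: le_trans (recent_mrca_prob_ge xp kr).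
  by rewrite ler_pM2r.
apply: (@le_trans _ _ (Q (k x n) * (M y0 - e) * gap n.-1 / gap (k x n).-1 / B n)); last first.
  by rewrite ler_pM2r ?invr_gt0.
rewrite le_eqVlt; apply/orP; left; apply/eqP; ring.
Unshelve. all: by end_near. Qed.

Lemma recent_mrca_ratio_cvg (x : R) : 0 < x ->
  fine (P (recent_mrca x n `&` small_population n)) / B n @[n --> \oo] -->
    alpha * Gamma (1 + alpha) * x * M (x `^ (- (1 / alpha))).
Proof.
move=> x0; set y := x `^ _; have y0 : 0 < y by exact: powR_gt0.
have G0 := Gamma_gt0 alpha_itv.
pose C := alpha * x * Gamma (1 + alpha).
have C0 : 0 < C by rewrite !mulr_gt0.
rewrite (_ : alpha * _ * x * M y = C * M y); last by rewrite /C; ring.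
apply: cvgr_bounds => e e0.
  (* t is both the relative decrease of x and the error allowed in M. The limit (M y - t) C (1 - t)
     falls short of C M y by less than t C (1 + M y) <= e/2. *)
  pose t := Num.min 2^-1 (e / (2 * C * (1 + M y))).
  have D0 : 0 < 2 * C * (1 + M y) by rewrite !mulr_gt0// ltr_pwDl.
  have t0 : 0 < t by rewrite lt_min invr_gt0 ltr0n divr_gt0.
  have t1 : t < 1 by rewrite gt_min invf_lt1 ?ltr1n.
  have tD : t * (2 * C * (1 + M y)) <= e by rewrite -ler_pdivlMr// ge_min lexx orbT.
  pose x' := x * (1 - t).
  have x'0 : 0 < x' by rewrite mulr_gt0// subr_gt0.
  have x'x : x' < x by rewrite gtr_pMr// gtrBl.
  have yy' : y < x' `^ (- (1 / alpha)).
    rewrite /y (powRN x) (powRN x') ltf_pV2 ?posrE ?powR_gt0//.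
    by rewrite gt0_ltr_powR ?nnegrE ?divr_gt0// ltW.
  (* Lowering x to x' raises the limiting level above y, so y itself is an admissible lower level
     and the bound contains M y instead of its left limit. *)
  have y'y : 0 < y < x' `^ (- (1 / alpha)) by rewrite y0.
  have H : (M y - t) * (Q (k x' n) / gap (k x' n).-1 * (gap n.-1 / B n)) @[n --> \oo] -->
      (M y - t) * (alpha * x' * Gamma (1 + alpha)).
    by apply: cvgMr; exact: shifted_factor_cvg.
  have lim_gt : C * M y - e < (M y - t) * (alpha * x' * Gamma (1 + alpha)).
    rewrite (_ : (M y - t) * _ = C * M y - t * (C * (1 + M y)) + t ^+ 2 * C); last first.
      by rewrite /C /x'; ring.
    have : 0 < t ^+ 2 * C by rewrite mulr_gt0// exprn_gt0.
    have : t * (2 * C * (1 + M y)) = 2 * (t * (C * (1 + M y))) by ring.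
    by lra.
  near=> n.
  have [p0 xp kr b0] : [/\ 0 < phi n, 0 < x * phi n, (1 < k x n <= n)%N & 0 < B n].
    by near: n; exact: near_range.
  have [_ xp' kr' _] : [/\ 0 < phi n, 0 < x' * phi n, (1 < k x' n <= n)%N & 0 < B n].
    by near: n; exact: near_range.
  apply: (@le_trans _ _ (fine (P (recent_mrca x' n `&` small_population n)) / B n)); last first.
    by rewrite ler_pM2r ?invr_gt0// recent_mrca_mono// ltW.
  apply: (@le_trans _ _ ((M y - t) * (Q (k x' n) / gap (k x' n).-1 * (gap n.-1 / B n)))).
    by near: n; exact: (cvgr_ge _ H).
  by near: n; exact: recent_mrca_ratio_ge.
(* Used twice, for right continuity of M and for the convergence to M; after multiplication by C the
   two errors total e/2. *)
pose e1 := e / (4 * C).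
have e10 : 0 < e1 by rewrite divr_gt0// mulr_gt0.
have [y1 yy1 My1] : exists2 y1, y < y1 & M y1 <= M y + e1.
  have rc : M z @[z --> y^'+] --> M y := cumulative_is_right_continuous M y.
  have [r /= r0 Hr] : \forall z \near y^'+, M z <= M y + e1.
    by apply: (cvgr_le _ rc); rewrite ltrDl.
  exists (y + r / 2); first by rewrite ltrDl divr_gt0.
  apply: Hr; last by rewrite ltrDl divr_gt0.
  rewrite /ball/= opprD addrA subrr sub0r normrN gtr0_norm ?divr_gt0//.
  by rewrite ltr_pdivrMr// ltr_pMr// ltr1n.
have H : (M y1 + e1) * factor x n @[n --> \oo] --> (M y1 + e1) * C.
  by apply: cvgMr; exact: factor_cvg.
have lim_lt : (M y1 + e1) * C < C * M y + e.
  have h : (M y1 + e1) * C <= (M y + e1 + e1) * C by rewrite ler_pM2r// lerD2r.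
  have e1E : e1 * C = e / 4 by rewrite /e1; field; rewrite gt_eqF.
  apply: (le_lt_trans h); rewrite 2!mulrDl e1E mulrC; lra.
near=> n.
apply: (@le_trans _ _ ((M y1 + e1) * factor x n)).
  by near: n; exact: recent_mrca_ratio_le.
by near: n; exact: (cvgr_le _ H).
Unshelve. all: by end_near. Qed.

End conditional_limit.

Theorem corollary4 (R : realType) (d : measure_display) (T : measurableType d)
    (P : probability T R)
    (xi : {RV P >-> nat}) (X : seq nat -> {RV P >-> nat})
    (alpha : R) (L : R -> R) (phi : nat -> R)
    (M : cumulativeBounded (0 : R) (1 : R)) (x : R) :
  let f := pgf xi in
  let tree := fun w : T => (fun u : seq nat => X u w) : offspring in
  let Z := fun (n : nat) (w : T) => popsize (tree w) n in
  let dist := fun (n : nat) (w : T) => mrca_dist (tree w) n in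
  let H := fun n : nat =>
    [set w | 0 < (1 - iter (Num.truncn (phi n)) f 0) * (Z n w)%:R <= 1] in
  0 < alpha < 1 ->
  iid_copies xi X ->
  ('E_P[fun w => ((xi w)%:R)%R] = 1)%E ->
  slowly_varying_at0 L ->
  (forall s : R, 0 <= s <= 1 ->
     f s = s + (1 - s) `^ (1 + alpha) * L (1 - s)) ->
  (forall n, (0 < n)%N -> 0 < phi n) ->
  phi n @[n --> \oo] --> +oo ->
  phi n / n%:R @[n --> \oo] --> (0 : R) ->
  is_limit_df alpha M ->
  0 < x ->
  cond_prob P [set w | (dist n w)%:R <= x * phi n] (H n) @[n --> \oo]
    --> alpha * Gamma (1 + alpha) * x * M (x `^ (- (1 / alpha))).
Proof.
move=> f tree Z dist H alpha_itv iidX mean1 svL fE _ phi_cvgy phi_small limM x0.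
have := recent_mrca_ratio_cvg alpha_itv iidX mean1 svL fE phi_cvgy phi_small limM x0.
apply: cvg_trans; apply: near_eq_cvg; apply: nearW => n.
by rewrite -(prob_small_population X _ alpha_itv mean1 svL fE).
Qed.
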